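(* Let $B$ be either the unit disc in $\mathbb C$ or $B=\mathbb C$. There exist locally trivial holomorphic fiber bundles over $B$ with fiber $\mathbb C^2$ whose gluing automorphisms of the fibers, in appropriate local trivializations, are polynomial automorphisms of $\mathbb C^2$ (depending holomorphically on the base point), and which are non-trivial and non-Stein.
   Context: For a locally trivial holomorphic fiber bundle over $B$ with fiber $\mathbb C^2$, given by an open cover $(U_\alpha)$ of $B$ and trivializations over the $U_\alpha$, the gluing maps have the form $(\zeta,z)\mapsto(\zeta,g_{\alpha\beta}(\zeta)(z))$ on $(U_\alpha\cap U_\beta)\times\mathbb C^2$, holomorphic in $(\zeta,z)$, with each $g_{\alpha\beta}(\zeta)$ a holomorphic automorphism of $\mathbb C^2$. The gluing automorphisms are polynomial if each $g_{\alpha\beta}(\zeta)$ is a polynomial automorphism of $\mathbb C^2$ (a bijective polynomial map with polynomial inverse). A bundle is non-Stein if its total space is not a Stein manifold, and trivial if it is isomorphic, as a holomorphic fiber bundle, to $B\times\mathbb C^2$. *)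

(* Defs.v *)
From HB Require Import structures.
From mathcomp Require Import all_boot all_order all_algebra.
From mathcomp Require Import complex.
From mathcomp Require Import all_classical all_reals all_analysis.

Set Implicit Arguments.
Unset Strict Implicit.
Unset Printing Implicit Defensive.

Import Order.TTheory GRing.Theory Num.Theory.
Import numFieldNormedType.Exports.

Local Open Scope classical_set_scope.
Local Open Scope ring_scope.

(* The complex numbers, packaged as a [numClosedFieldType] so that the norm
   and topology which the library attaches to every such field are found by
   unification (they are not found on the bare type [R[i]]).  The norm takes
   its values in [CC R], where [0 <= x] means that [x] is a nonnegative real. *)
Definition CC (R : realType) : numClosedFieldType := (R[i] : numClosedFieldType).

(* Over [CC R], [differentiable] is complex Frechet differentiability, so that
   on an open set of a finite-dimensional space this is holomorphy. *)
Definition holomorphic_on (R : realType) (V W : normedModType (CC R))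
    (O : set V) (f : V -> W) : Prop :=
  forall v, O v -> differentiable f v.

(* The functions [cmap] and [cinv] are total; their values outside [cdom] and
   [cimg] are irrelevant. *)
Record chart (R : realType) (T : topologicalType) (V : normedModType (CC R)) :=
  Chart {
    cdom : set T;
    cimg : set V;
    cmap : T -> V;
    cinv : V -> T;
    cdom_open : open cdom;
    cimg_open : open cimg;
    cmap_cimg : forall x, cdom x -> cimg (cmap x);
    cinv_cdom : forall v, cimg v -> cdom (cinv v);
    cmapK : forall x, cdom x -> cinv (cmap x) = x;
    cinvK : forall v, cimg v -> cmap (cinv v) = v;
    cmap_continuous : {within cdom, continuous cmap};
    cinv_continuous : {within cimg, continuous cinv}
  }.

(* Complex manifolds modelled on [V], which is meant to be finite-dimensional:
   it is C x C^2 below. *)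
Record complex_manifold (R : realType) (V : normedModType (CC R)) :=
  ComplexManifold {
    space :> topologicalType;
    atlas : set (chart space V);
    space_hausdorff : hausdorff_space space;
    space_second_countable : @second_countable space;
    atlas_cover : forall x : space, exists2 c, atlas c & cdom c x;
    atlas_compatible : forall c d, atlas c -> atlas d ->
      holomorphic_on (cimg c `&` cinv c @^-1` cdom d) (cmap d \o cinv c)
  }.

Definition holomorphic_from (R : realType) (V W : normedModType (CC R))
    (M : complex_manifold V) (O : set M) (f : M -> W) : Prop :=
  forall c, atlas c -> holomorphic_on (cimg c `&` cinv c @^-1` O) (f \o cinv c).

Definition holomorphic_into (R : realType) (V W : normedModType (CC R))
    (M : complex_manifold V) (O : set W) (f : W -> M) : Prop :=
  {within O, continuous f} /\
  forall c, atlas c -> holomorphic_on (O `&` f @^-1` cdom c) (cmap c \o f).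

Definition holomorphic_function (R : realType) (V : normedModType (CC R))
    (M : complex_manifold V) (f : M -> CC R) : Prop :=
  holomorphic_from setT f.

(* The points x with |f x| <= sup_K |f| for every holomorphic f on M, the
   supremum being expressed through its upper bounds. *)
Definition holomorphic_hull (R : realType) (V : normedModType (CC R))
    (M : complex_manifold V) (K : set M) : set M :=
  [set x | forall f : M -> CC R, holomorphic_function f ->
     forall b : CC R, (forall y, K y -> `|f y| <= b) -> `|f x| <= b].

Definition holomorphically_convex (R : realType) (V : normedModType (CC R))
    (M : complex_manifold V) : Prop :=
  forall K : set M, compact K -> compact (holomorphic_hull K).

Definition holomorphically_separable (R : realType) (V : normedModType (CC R))
    (M : complex_manifold V) : Prop :=
  forall x y : M, x <> y ->
    exists2 f : M -> CC R, holomorphic_function f & f x <> f y.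

(* Around every point, some global holomorphic map into [V] (that is, dim V
   global holomorphic functions) is a local coordinate system. *)
Definition has_global_coordinates (R : realType) (V : normedModType (CC R))
    (M : complex_manifold V) : Prop :=
  forall x : M, exists2 f : M -> V, holomorphic_from setT f &
    forall c, atlas c -> cdom c x ->
      bijective ('d (f \o cinv c) (cmap c x) : V -> V).

Definition stein (R : realType) (V : normedModType (CC R))
    (M : complex_manifold V) : Prop :=
  [/\ holomorphically_convex M, holomorphically_separable M
    & has_global_coordinates M].

(* Biholomorphic trivializations over [U] of a map [p] from a manifold to C:
   [e |-> (p e, tmap e)] maps the preimage of [U] onto U x F, and [tinv] is its
   inverse. *)
Record trivialization (R : realType) (F : normedModType (CC R))
    (M : complex_manifold (CC R * F)%type) (p : M -> CC R) (U : set (CC R)) :=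
  Trivialization {
    tmap : M -> F;
    tinv : CC R * F -> M;
    tmapK : forall e, U (p e) -> tinv (p e, tmap e) = e;
    tinv_proj : forall zeta z, U zeta -> p (tinv (zeta, z)) = zeta;
    tinvK : forall zeta z, U zeta -> tmap (tinv (zeta, z)) = z;
    tmap_holomorphic : holomorphic_from (p @^-1` U) tmap;
    tinv_holomorphic : holomorphic_into (U `*` setT) tinv
  }.

(* Locally trivial holomorphic fiber bundles with fiber [F] over an open subset
   [B] of C. *)
Record holomorphic_bundle (R : realType) (B : set (CC R))
    (F : normedModType (CC R)) :=
  HolomorphicBundle {
    total_space : complex_manifold (CC R * F)%type;
    bundle_proj : total_space -> CC R;
    bundle_proj_base : forall e, B (bundle_proj e);
    bundle_proj_holomorphic : holomorphic_function bundle_proj;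
    locally_trivial : forall zeta, B zeta ->
      exists U : set (CC R),
        [/\ open U, U `<=` B, U zeta & inhabited (trivialization bundle_proj U)]
  }.

(* A trivialization over the whole base is an isomorphism of holomorphic
   bundles with B x F. *)
Definition trivial_bundle (R : realType) (B : set (CC R))
    (F : normedModType (CC R)) (E : holomorphic_bundle B F) : Prop :=
  inhabited (trivialization (@bundle_proj R B F E) B).

Record trivializing_cover (R : realType) (B : set (CC R))
    (F : normedModType (CC R)) (E : holomorphic_bundle B F) :=
  TrivializingCover {
    tc_index : Type;
    tc_set : tc_index -> set (CC R);
    tc_triv : forall a, trivialization (@bundle_proj R B F E) (tc_set a);
    tc_open : forall a, open (tc_set a);
    tc_cover : \bigcup_a tc_set a = B
  }.

(* The map g_ab(zeta) such that the change of trivialization over the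
   intersection of U_a and U_b is (zeta, z) |-> (zeta, g_ab(zeta)(z)). *)
Definition gluing (R : realType) (B : set (CC R)) (F : normedModType (CC R))
    (E : holomorphic_bundle B F) (C : trivializing_cover E)
    (a b : tc_index C) (zeta : CC R) (z : F) : F :=
  tmap (tc_triv a) (tinv (tc_triv b) (zeta, z)).

Definition polynomial_map (R : realType) (g : CC R * CC R -> CC R * CC R) :=
  exists P Q : {poly {poly CC R}},
    forall z, g z = (P.[z.1, z.2], Q.[z.1, z.2]).

Definition polynomial_automorphism (R : realType)
    (g : CC R * CC R -> CC R * CC R) : Prop :=
  polynomial_map g /\
  exists h, [/\ polynomial_map h, cancel g h & cancel h g].

(* The gluing maps are polynomial automorphisms of C^2 depending
   holomorphically on the base point. *)
Definition polynomial_gluing (R : realType) (B : set (CC R))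
    (E : holomorphic_bundle B (CC R * CC R)%type)
    (C : trivializing_cover E) : Prop :=
  forall a b : tc_index C,
    holomorphic_on ((tc_set a `&` tc_set b) `*` setT)
      (fun x : CC R * (CC R * CC R) => gluing a b x.1 x.2) /\
    forall zeta, tc_set a zeta -> tc_set b zeta ->
      polynomial_automorphism (gluing a b zeta).

Definition unit_disc (R : realType) : set (CC R) := [set z : CC R | `|z| < 1].

(* Main.v *)
Require Import Defs.
From mathcomp Require Import all_boot all_order all_algebra.
From mathcomp Require Import complex ring lra zify.
From mathcomp Require Import all_classical all_reals all_analysis.
Import Order.TTheory GRing.Theory Num.Theory.
Import numFieldNormedType.Exports.
Import Normc.
Local Open Scope classical_set_scope.
Local Open Scope ring_scope.

(** Non-triviality and failure of the Stein property come from a single fact: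
    the total space constructed below contains two distinct points of one fibre
    at which every holomorphic function takes the same value.  Such points
    contradict holomorphic separability, and in a trivial bundle the fibre
    coordinates would separate them.

    The bundle.  Let [csq] be a continuous function on the plane which on
    Re zeta < 1/4 is the holomorphic branch, with positive real part, of the
    square root of 1 - 4 zeta.  The total space is B x C^2 as a topological
    space, with flat coordinates (zeta, x, y).  Over Re zeta > -1/4 the fibre
    coordinates are (x, y - csq(zeta) x^d), over Re zeta < 1/4 they are
    (x - csq(-zeta) y^d, y).  On the common strip both shears are holomorphic in
    zeta, so the gluing map is a composition of two polynomial shears depending
    holomorphically on zeta, although neither shear extends holomorphically to
    the whole base.

    The monodromy.  Over the first half of the base a holomorphic function on
    the bundle is a holomorphic function of zeta, x and y - csq(zeta) x^d.  Along
    a loop around the branch point 1/4 the square root changes sign.  Hence, if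
    F(zeta, x, y) is the function in flat coordinates near zeta = 0, its
    continuation along the loop is F(zeta, x, y + 2 csq(zeta) x^d).  A loop
    around -1/4 in the other half does the same with x and y exchanged.

    The growth argument.  Suppose |F| <= b for |zeta| <= 1/200 and
    |x|, |y| <= r = 100^N, where b also bounds the function over a fixed compact
    set.  The maximum principle along the loop, applied after rescaling x and y
    by t^N, gives |F(zeta, x, y + 2 csq(zeta) x^d)| <= b for
    |x|, |y| <= s = (50/49)^N ([loop_continuation]).  The ratio of log r and
    log s depends neither on N nor on d.  The curves y (y - 2 csq(zeta) x^d) = c
    over |x| <= s have their boundary in the polydisc of radius s and in its
    image under the shear; if d is large, they fill |x| <= 1/2, |y| <= r^4, where
    therefore |F| <= b ([tube_hull]).  The other loop gives the same bound for
    |x| <= r^4, |y| <= 1/2, and the hyperbolas x y = c then give it for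
    |x|, |y| <= 100 r ([hyper_hull]).  By induction F is bounded by b on the
    whole fibre over 0, and by Liouville's theorem it is constant there
    ([fiber_points_not_separated]).

    The functions of the statement are only assumed to be complex
    differentiable at each point.  The maximum principle for them is derived
    from Goursat's lemma on rectangles: in the coordinate w with
    z = z0 + exp(w), the integral of the real part over a period of the
    imaginary direction does not depend on Re w, which bounds the value at the
    centre of a disc by the values on its boundary circle. *)

Set Implicit Arguments.
Unset Strict Implicit.
Unset Printing Implicit Defensive.

(** * Complex numbers in real coordinates *)

(** The norm of [CC R] takes its values in [CC R]; [nc] is the same norm with
    values in the totally ordered field [R], where estimates are made. *)
Definition nc (R : realType) (z : CC R) : R := normc (z : R[i]).
Definition rc (R : realType) (x : R) : CC R := (x%:C)%C.
Definition cx (R : realType) (x y : R) : CC R := (x +i* y)%C.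
Definition re (R : realType) (z : CC R) : R := complex.Re z.
Definition im (R : realType) (z : CC R) : R := complex.Im z.

Section projections.
Variables (K : numFieldType) (V W : normedModType K).

Lemma dif_id (x : V) : differentiable (fun v : V => v) x.
Proof. by have H := is_diff_id x; apply: ex_diff. Qed.

Lemma dif_fst (x : V * W) : differentiable (fun v : V * W => v.1) x.
Proof.
have H := @linear_differentiable K (V * W)%type V fst x.
by apply: H => y; exact: cvg_fst.
Qed.

Lemma dif_snd (x : V * W) : differentiable (fun v : V * W => v.2) x.
Proof.
have H := @linear_differentiable K (V * W)%type W snd x.
by apply: H => y; exact: cvg_snd.
Qed.

Lemma dif_X (f : V -> K) n (x : V) : differentiable f x ->
  differentiable (fun v => f v ^+ n) x.
Proof.
move=> df; elim: n => [|n IH].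
  by under eq_fun do rewrite expr0; exact: differentiable_cst.
by under eq_fun do rewrite exprS; exact: differentiableM.
Qed.

End projections.

Section basics.
Variable R : realType.
Implicit Types (z w : CC R) (x y : R).

Lemma normE z : `|z| = rc (nc z).
Proof. by []. Qed.

Lemma nc_sqr z : nc z ^+ 2 = re z ^+ 2 + im z ^+ 2.
Proof. by case: z => a b; rewrite /nc /= sqr_sqrtr // addr_ge0 ?sqr_ge0. Qed.

Lemma nc_ge0 z : 0 <= nc z.
Proof. by case: z => a b; exact: sqrtr_ge0. Qed.

Lemma ncD z w : nc (z + w) <= nc z + nc w.
Proof. exact: le_normcD. Qed.
Lemma ncM z w : nc (z * w) = nc z * nc w.
Proof. exact: normcM. Qed.
Lemma ncV z : nc z^-1 = (nc z)^-1.
Proof. exact: normcV. Qed.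
Lemma ncN z : nc (- z) = nc z.
Proof. exact: normcN. Qed.
Lemma nc0 : nc (0 : CC R) = 0.
Proof. exact: normc0. Qed.
Lemma nc1 : nc (1 : CC R) = 1.
Proof. exact: normc1. Qed.
Lemma ncB z w : nc (z - w) <= nc z + nc w.
Proof. by rewrite -(ncN w) ncD. Qed.
Lemma ncC z w : nc (z - w) = nc (w - z).
Proof. by rewrite -ncN opprB. Qed.
Lemma ncX z n : nc (z ^+ n) = nc z ^+ n.
Proof. by elim: n => [|n IH]; rewrite ?expr0 ?nc1 // !exprS ncM IH. Qed.
Lemma nc_eq0 z : (nc z == 0) = (z == 0).
Proof. by apply/eqP/eqP => [/eq0_normc|->] //; rewrite nc0. Qed.
Lemma nc_gt0 z : (0 < nc z) = (z != 0).
Proof. by rewrite lt_neqAle eq_sym nc_eq0 nc_ge0 andbT. Qed.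
Lemma nc_rc x : nc (rc x) = `|x|.
Proof. by rewrite /nc /rc /= expr0n /= addr0 sqrtr_sqr. Qed.
Lemma ncBD z w : nc z <= nc w + nc (z - w).
Proof. by rewrite -{1}(subrK w z) addrC ncD. Qed.

Lemma re_le z : `|re z| <= nc z.
Proof.
rewrite -(ler_pXn2r (n := 2)) ?nnegrE ?nc_ge0 //.
by rewrite nc_sqr real_normK ?num_real // lerDl sqr_ge0.
Qed.
Lemma im_le z : `|im z| <= nc z.
Proof.
rewrite -(ler_pXn2r (n := 2)) ?nnegrE ?nc_ge0 //.
by rewrite nc_sqr real_normK ?num_real // lerDr sqr_ge0.
Qed.
Lemma nc_le z : nc z <= `|re z| + `|im z|.
Proof.
rewrite -(ler_pXn2r (n := 2)) ?nnegrE ?nc_ge0 ?addr_ge0 //.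
rewrite nc_sqr sqrrD !real_normK ?num_real // addrAC lerDl.
by rewrite mulrn_wge0 // mulr_ge0.
Qed.

Lemma reD z w : re (z + w) = re z + re w. Proof. by case: z; case: w. Qed.
Lemma imD z w : im (z + w) = im z + im w. Proof. by case: z; case: w. Qed.
Lemma reN z : re (- z) = - re z. Proof. by case: z. Qed.
Lemma imN z : im (- z) = - im z. Proof. by case: z. Qed.
Lemma reB z w : re (z - w) = re z - re w. Proof. by rewrite reD reN. Qed.
Lemma imB z w : im (z - w) = im z - im w. Proof. by rewrite imD imN. Qed.
Lemma reM z w : re (z * w) = re z * re w - im z * im w.
Proof. by case: z; case: w. Qed.
Lemma imM z w : im (z * w) = re z * im w + im z * re w.
Proof. by case: z => a b; case: w => c d. Qed.
Lemma re_rc x : re (rc x) = x. Proof. by []. Qed.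
Lemma im_rc x : im (rc x) = 0. Proof. by []. Qed.
Lemma re1 : re (1 : CC R) = 1. Proof. by []. Qed.
Lemma im1 : im (1 : CC R) = 0. Proof. by []. Qed.
Lemma re_cx x y : re (cx x y) = x. Proof. by []. Qed.
Lemma im_cx x y : im (cx x y) = y. Proof. by []. Qed.
Lemma cxE z : cx (re z) (im z) = z. Proof. by case: z. Qed.
Lemma cx_inj z w : re z = re w -> im z = im w -> z = w.
Proof. by move=> h1 h2; rewrite -(cxE z) -(cxE w) h1 h2. Qed.

Lemma natE n : (n%:R : CC R) = rc n%:R.
Proof. by rewrite /rc /= rmorph_nat. Qed.
Lemma re_nat n : re (n%:R : CC R) = n%:R.
Proof. by rewrite natE. Qed.
Lemma im_nat n : im (n%:R : CC R) = 0.
Proof. by rewrite natE. Qed.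
Lemma nc_nat n : nc (n%:R : CC R) = n%:R.
Proof. by rewrite natE nc_rc ger0_norm. Qed.

Lemma re_natM n z : re (n%:R * z) = n%:R * re z.
Proof. by rewrite natE reM re_rc im_rc mul0r subr0. Qed.
Lemma im_natM n z : im (n%:R * z) = n%:R * im z.
Proof. by rewrite natE imM re_rc im_rc mul0r addr0. Qed.

(** Neighbourhoods are generated by balls whose radius is a positive element of
    [CC R]; such an element is a positive real. *)
Lemma nbhsCP z (A : set (CC R)) :
  nbhs z A <-> exists2 e : R, 0 < e & forall w, nc (w - z) < e -> A w.
Proof.
split.
  case/nbhs_ballP => e e0 H.
  have [er ei] : 0 < re e /\ im e = 0.
    by move: e0; rewrite /= ltcE => /andP[/eqP h1 h2].
  exists (re e) => // w wz; apply: H; rewrite /ball /= normE ncC.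
  by rewrite -(cxE e) ei; rewrite /rc ltcR.
case=> e e0 H; apply/nbhs_ballP; exists (rc e); first by rewrite /= /rc ltcR.
by move=> w; rewrite /ball /= normE ncC /rc ltcR; exact: H.
Qed.

Lemma continuousCP (f : CC R -> CC R) z : {for z, continuous f} <->
  forall e : R, 0 < e -> exists2 d : R, 0 < d &
    forall w, nc (w - z) < d -> nc (f w - f z) < e.
Proof.
split=> [H e e0|H A /nbhsCP[e e0 HA]].
  have /nbhsCP[d d0 Hd] : nbhs z (f @^-1` [set w | nc (w - f z) < e]).
    by apply: H; apply/nbhsCP; exists e.
  by exists d.
have [d d0 Hd] := H e e0.
by apply/nbhsCP; exists d => // w /Hd /HA.
Qed.

(** The first order expansion behind complex differentiability, with real
    epsilons. *)
Lemma differentiableCP (f : CC R -> CC R) z : differentiable f z <->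
  exists p : CC R, forall e : R, 0 < e -> exists2 d : R, 0 < d &
    forall w, nc (w - z) < d -> nc (f w - f z - p * (w - z)) <= e * nc (w - z).
Proof.
split.
  move=> /derivable1_diffP df.
  move: (df) => /cvg_ex [p Hp]; exists p => e e0.
  have : nbhs p [set w | nc (w - p) < e] by apply/nbhsCP; exists e.
  move=> /Hp /nbhsCP /= [d d0 Hd]; exists d => // w wd.
  have [->|wz] := eqVneq w z; first by rewrite !subrr mulr0 subr0 nc0 mulr0.
  have := Hd (w - z); rewrite subr0 subr_eq0 => /(_ wd wz) /=.
  rewrite [_ *: 1]mulr1 subrK => /ltW.
  rewrite -[_ *: _]/(_ * _) => H.
  have nz : w - z != 0 by rewrite subr_eq0.
  have -> : f w - f z - p * (w - z) = ((w - z)^-1 * (f w - f z) - p) * (w - z).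
    by rewrite mulrBl mulrAC mulVf // mul1r.
  by rewrite ncM ler_wpM2r // nc_ge0.
case=> p Hp; apply/derivable1_diffP/cvg_ex; exists p.
move=> A /nbhsCP[e e0 HA].
have [d d0 Hd] := Hp (e / 2) ltac:(by rewrite divr_gt0).
apply/nbhsCP; exists d => // h; rewrite subr0 => hd h0 /=; apply: HA.
rewrite [h *: 1]mulr1 -[_ *: _]/(_ * _).
have := Hd (h + z); rewrite addrK => /(_ hd) H.
have -> : h^-1 * (f (h + z) - f z) - p = h^-1 * (f (h + z) - f z - p * h).
  by rewrite [RHS]mulrBr (mulrC p) mulKf.
rewrite ncM ncV mulrC ltr_pdivrMr ?nc_gt0 //.
apply: le_lt_trans H _; rewrite ltr_pM2r ?nc_gt0 //; lra.
Qed.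

End basics.

(** * Contour integrals over rectangles *)

(** The integral over a compact interval, used below only for functions that
    are continuous at every point of the interval. *)
Definition segint (R : realType) (a b : R) (f : R -> R) : R :=
  \int[@lebesgue_measure R]_(x in `[a, b]) f x.

Section segint.
Variable R : realType.
Implicit Types (a b m M : R) (f g : R -> R).

Definition cont_on a b f := forall x, a <= x <= b -> {for x, continuous f}.

Lemma cont_onB a b f g : cont_on a b f -> cont_on a b g ->
  cont_on a b (fun x => f x - g x).
Proof. by move=> cf cg x xab; apply: cvgB; [exact: cf|exact: cg]. Qed.

Lemma segint_integrable a b f : cont_on a b f ->
  (@lebesgue_measure R).-integrable `[a, b] (EFin \o f).
Proof.
move=> cf; apply: continuous_compact_integrable; first exact: segment_compact.
apply: continuous_in_subspaceT => x; rewrite inE /= in_itv /=; exact: cf.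
Qed.

Lemma segint_split a m b f : a <= m -> m <= b -> cont_on a b f ->
  segint a b f = segint a m f + segint m b f.
Proof.
move=> am mb cf.
have H := @Rintegral_itvB R f (BLeft a) (BRight b) m (segint_integrable cf).
rewrite !bnd_simp in H; have {H} := H am mb.
rewrite /segint => /(canRL (subrK _)) ->; rewrite addrC; congr (_ + _).
apply: Rintegral_itv_obnd_cbnd.
apply: integrableS (segint_integrable cf) => // x /=; rewrite !in_itv /= => /andP[h1 h2].
by rewrite h2 andbT ltW // (le_lt_trans am h1).
Qed.

Lemma segintD a b f g : cont_on a b f -> cont_on a b g ->
  segint a b (fun x => f x + g x) = segint a b f + segint a b g.
Proof. by move=> cf cg; rewrite /segint RintegralD //; exact: segint_integrable. Qed.
Lemma segintB a b f g : cont_on a b f -> cont_on a b g ->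
  segint a b (fun x => f x - g x) = segint a b f - segint a b g.
Proof. by move=> cf cg; rewrite /segint RintegralB //; exact: segint_integrable. Qed.

Lemma segint_cst a b M : a <= b -> segint a b (fun=> M) = M * (b - a).
Proof.
move=> ab; rewrite /segint Rintegral_cst //= lebesgue_measure_itv /= lte_fin.
case: ltP => //= ba; have -> : b = a by apply/eqP; rewrite eq_le ab ba.
by rewrite subrr.
Qed.

Lemma cont_on_cst a b M : cont_on a b (fun=> M).
Proof. by move=> x _; exact: cvg_cst. Qed.

Lemma segint_le a b f M : a <= b -> cont_on a b f ->
  (forall x, a <= x <= b -> f x <= M) -> segint a b f <= M * (b - a).
Proof.
move=> ab cf H; rewrite -segint_cst // /segint.
apply: (le_Rintegral _ (segint_integrable cf) (segint_integrable (@cont_on_cst a b M))) => //.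
Qed.

Lemma segint_ge a b f M : a <= b -> cont_on a b f ->
  (forall x, a <= x <= b -> M <= f x) -> M * (b - a) <= segint a b f.
Proof.
move=> ab cf H; rewrite -segint_cst // /segint.
apply: (le_Rintegral _ (segint_integrable (@cont_on_cst a b M)) (segint_integrable cf)) => //.
Qed.

Lemma segint_norm_le a b f M : a <= b -> cont_on a b f ->
  (forall x, a <= x <= b -> `|f x| <= M) -> `|segint a b f| <= M * (b - a).
Proof.
move=> ab cf H; rewrite ler_norml -mulNr; apply/andP; split.
  by apply: segint_ge => // x /H; rewrite ler_norml => /andP[].
by apply: segint_le => // x /H; rewrite ler_norml => /andP[].
Qed.

End segint.

Section rectangles.
Variables (R : realType) (g : CC R -> CC R).
Let u x y := re (g (cx x y)).
Let v x y := im (g (cx x y)).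

Lemma cxB (x y x' y' : R) : cx x y - cx x' y' = cx (x - x') (y - y').
Proof. by []. Qed.

Lemma nbhsRP (x : R) (A : set R) :
  (exists2 e : R, 0 < e & forall w, `|w - x| < e -> A w) -> nbhs x A.
Proof.
case=> e e0 H; apply/nbhs_ballP; exists e => // w.
by rewrite /ball /= distrC; exact: H.
Qed.

Lemma re_cont_y x y : differentiable g (cx x y) -> {for y, continuous (u x)}.
Proof.
move=> dg A /nbhs_ballP[e e0 HA]; apply: nbhsRP.
have /continuousCP /(_ e e0) [d d0 Hd] : {for cx x y, continuous g}.
  exact: differentiable_continuous.
exists d => // w wd; apply: HA; rewrite /ball /= /u -reB.
apply: le_lt_trans (re_le _) _; rewrite ncC; apply: Hd.
by rewrite cxB subrr; apply: le_lt_trans (nc_le _) _; rewrite re_cx im_cx normr0 add0r.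
Qed.

Lemma im_cont_x x y : differentiable g (cx x y) ->
  {for x, continuous (v^~ y)}.
Proof.
move=> dg A /nbhs_ballP[e e0 HA]; apply: nbhsRP.
have /continuousCP /(_ e e0) [d d0 Hd] : {for cx x y, continuous g}.
  exact: differentiable_continuous.
exists d => // w wd; apply: HA; rewrite /ball /= /v -imB.
apply: le_lt_trans (im_le _) _; rewrite ncC; apply: Hd.
by rewrite cxB subrr; apply: le_lt_trans (nc_le _) _; rewrite re_cx im_cx normr0 addr0.
Qed.

(** The imaginary part of the integral of g(z) dz along the boundary of [a, b]
    x [c, d].  If g is periodic in the imaginary direction with period d - c,
    the horizontal sides cancel, and the vanishing of this real-valued
    functional compares the integrals of the real part over the two vertical
    sides. *)
Definition im_contour (a b c d : R) : R :=
  segint c d (fun y => u b y - u a y) + segint a b (fun x => v x c - v x d).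

Definition diff_on_rect (a b c d : R) :=
  forall x y, a <= x <= b -> c <= y <= d -> differentiable g (cx x y).

Lemma diff_on_rectS a b c d a' b' c' d' : a <= a' -> b' <= b -> c <= c' -> d' <= d ->
  diff_on_rect a b c d -> diff_on_rect a' b' c' d'.
Proof.
move=> h1 h2 h3 h4 H x y /andP[x1 x2] /andP[y1 y2].
by apply: H; apply/andP; split; lra.
Qed.

Lemma cont_u a b c d x : diff_on_rect a b c d -> a <= x <= b -> cont_on c d (u x).
Proof. by move=> H xab y ycd; apply: re_cont_y; exact: H. Qed.
Lemma cont_v a b c d y : diff_on_rect a b c d -> c <= y <= d -> cont_on a b (v^~ y).
Proof. by move=> H ycd x xab; apply: im_cont_x; exact: H. Qed.

Lemma im_contour_splitx a m b c d : a <= m -> m <= b -> c <= d -> diff_on_rect a b c d ->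
  im_contour a b c d = im_contour a m c d + im_contour m b c d.
Proof.
move=> am mb cd H; rewrite /im_contour.
have ca : cont_on c d (u a) by apply: cont_u H _; rewrite lexx (le_trans am mb).
have cb : cont_on c d (u b) by apply: cont_u H _; rewrite lexx (le_trans am mb).
have cm : cont_on c d (u m) by apply: cont_u H _; rewrite am mb.
rewrite (@segint_split _ a m b) //; last first.
  by apply: cont_onB; apply: cont_v H _; rewrite lexx cd.
rewrite (segintB cb ca) (segintB cm ca) (segintB cb cm); ring.
Qed.

Lemma im_contour_splity a b c m d : a <= b -> c <= m -> m <= d -> diff_on_rect a b c d ->
  im_contour a b c d = im_contour a b c m + im_contour a b m d.
Proof.
move=> ab cm md H; rewrite /im_contour.
have cc : cont_on a b (v^~ c) by apply: cont_v H _; rewrite lexx (le_trans cm md).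
have cd : cont_on a b (v^~ d) by apply: cont_v H _; rewrite lexx (le_trans cm md).
have cvm : cont_on a b (v^~ m) by apply: cont_v H _; rewrite cm md.
rewrite (@segint_split _ c m d) //; last first.
  by apply: cont_onB; apply: cont_u H _; rewrite lexx ab.
rewrite (segintB cc cd) (segintB cc cvm) (segintB cvm cd); ring.
Qed.

Lemma im_contour_quarter a m b c n d : a <= m -> m <= b -> c <= n -> n <= d ->
  diff_on_rect a b c d ->
  `|im_contour a b c d| <= `|im_contour a m c n| + `|im_contour a m n d|
     + (`|im_contour m b c n| + `|im_contour m b n d|).
Proof.
move=> am mb cn nd H.
rewrite (im_contour_splitx am mb (le_trans cn nd) H) (@im_contour_splity a m c n d) //; last first.
  by apply: diff_on_rectS H.
rewrite (@im_contour_splity m b c n d) //; last by apply: diff_on_rectS H.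
rewrite (le_trans (ler_normD _ _)) // lerD // (le_trans (ler_normD _ _)) //.
Qed.

(** Subtracting the first order expansion does not change the functional,
    because the contributions of an affine function to the two pairs of
    opposite sides cancel. *)
Lemma im_contour_small x y e : differentiable g (cx x y) -> 0 < e ->
  exists2 r, 0 < r & forall a b c d, a <= x <= b -> c <= y <= d ->
    b - a + (d - c) < r -> diff_on_rect a b c d ->
    `|im_contour a b c d| <= e * (b - a + (d - c)) ^+ 2.
Proof.
move=> /differentiableCP[p Hp] e0.
have [r r0 Hr] := Hp (e / 4) ltac:(by rewrite divr_gt0).
exists r => // a b c d /andP[ax xb] /andP[cy yd] sr H.
set s := b - a + (d - c) in sr *.
have cl x' y' : a <= x' <= b -> c <= y' <= d -> nc (cx x' y' - cx x y) <= s.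
  move=> /andP[h1 h2] /andP[h3 h4]; apply: le_trans (nc_le _) _.
  rewrite cxB re_cx im_cx /s lerD // ler_norml; apply/andP; split; lra.
have E x' y' : a <= x' <= b -> c <= y' <= d ->
    nc (g (cx x' y') - g (cx x y) - p * (cx x' y' - cx x y)) <= e / 4 * s.
  move=> h1 h2; have h3 := cl _ _ h1 h2.
  apply: le_trans (Hr _ (le_lt_trans h3 sr)) _.
  by rewrite ler_wpM2l // ltW // divr_gt0.
have ab : a <= b by lra.
have cd : c <= d by lra.
have ia : a <= a <= b by rewrite lexx.
have ib : a <= b <= b by rewrite lexx andbT.
have ic : c <= c <= d by rewrite lexx.
have id : c <= d <= d by rewrite lexx andbT.
have U : segint c d (fun y' => u b y' - u a y') =
   segint c d (fun y' => (u b y' - u a y') - re p * (b - a)) + re p * (b - a) * (d - c).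
  rewrite -(@segint_cst _ c d) // -segintD.
  - by congr (segint _ _ _); apply/funext => z; rewrite subrK.
  - apply: cont_onB; last exact: cont_on_cst.
    by apply: cont_onB; apply: cont_u H _.
  - exact: cont_on_cst.
have V : segint a b (fun x' => v x' c - v x' d) =
   segint a b (fun x' => (v x' c - v x' d) - re p * (c - d)) + re p * (c - d) * (b - a).
  rewrite -(@segint_cst _ a b) // -segintD.
  - by congr (segint _ _ _); apply/funext => z; rewrite subrK.
  - apply: cont_onB; last exact: cont_on_cst.
    by apply: cont_onB; apply: cont_v H _.
  - exact: cont_on_cst.
have -> : im_contour a b c d = segint c d (fun y' => (u b y' - u a y') - re p * (b - a))
    + segint a b (fun x' => (v x' c - v x' d) - re p * (c - d)).
  rewrite /im_contour U V; ring.
have B1 : `|segint c d (fun y' => (u b y' - u a y') - re p * (b - a))|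
    <= e / 2 * s * (d - c).
  apply: segint_norm_le => //.
    apply: cont_onB; last exact: cont_on_cst.
    by apply: cont_onB; apply: cont_u H _.
  move=> y' hy'; have h1 := E _ _ ib hy'; have h2 := E _ _ ia hy'.
  move: (le_trans (re_le _) h1) (le_trans (re_le _) h2).
  rewrite !(reB, reM) !cxB !re_cx !im_cx -!/(u _ _) !ler_norml.
  move=> /andP[k1 k2] /andP[k3 k4]; apply/andP; split; lra.
have B2 : `|segint a b (fun x' => (v x' c - v x' d) - re p * (c - d))|
    <= e / 2 * s * (b - a).
  apply: segint_norm_le => //.
    apply: cont_onB; last exact: cont_on_cst.
    by apply: cont_onB; apply: cont_v H _.
  move=> y' hy'; have h1 := E _ _ hy' ic; have h2 := E _ _ hy' id.
  move: (le_trans (im_le _) h1) (le_trans (im_le _) h2).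
  rewrite !(imB, imM) !cxB !re_cx !im_cx -!/(v _ _) !ler_norml.
  move=> /andP[k1 k2] /andP[k3 k4]; apply/andP; split; lra.
apply: le_trans (ler_normD _ _) _.
apply: le_trans (lerD B1 B2) _.
have -> : e / 2 * s * (d - c) + e / 2 * s * (b - a) = e / 2 * s ^+ 2.
  by rewrite /s; ring.
have : 0 <= s ^+ 2 by exact: sqr_ge0.
nra.
Qed.

End rectangles.

(** * Goursat's lemma *)

Section goursat_thm.
Variables (R : realType) (g : CC R -> CC R).

Lemma half_exp_small (L r : R) : 0 < r -> exists n, L * (1 / 2) ^+ n < r.
Proof.
move=> r0.
have H : (geometric (`|L| + 1) (1 / 2 : R)) @ \oo --> (0 : R).
  by apply: cvg_geometric; rewrite ger0_norm; lra.
have [n _ Hn] : \forall n \near \oo, `|0 - geometric (`|L| + 1) (1 / 2 : R) n| < r.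
  by move/cvgrPdist_lt : H; apply.
exists n; have := Hn n (leqnn n); rewrite /= sub0r normrN /geometric /=.
move=> /(le_lt_trans (ler_norm _)); apply: le_lt_trans.
apply: ler_wpM2r; first by apply: exprn_ge0; lra.
have := ler_norm L; lra.
Qed.

(** The bisection step of Goursat's lemma. *)
Lemma im_contour_pick x y w h q : 0 <= w -> 0 <= h ->
  diff_on_rect g x (x + w + w) y (y + h + h) ->
  4 * q <= `|im_contour g x (x + w + w) y (y + h + h)| ->
  exists x' y', [/\ x' = x \/ x' = x + w, y' = y \/ y' = y + h &
    q <= `|im_contour g x' (x' + w) y' (y' + h)|].
Proof.
move=> w0 h0 H hq.
have /(le_trans hq) := @im_contour_quarter R g x (x + w) (x + w + w) y (y + h)
  (y + h + h) ltac:(by rewrite lerDl) ltac:(by rewrite lerDl)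
  ltac:(by rewrite lerDl) ltac:(by rewrite lerDl) H.
move=> Q.
have [k1|k1] := lerP q `|im_contour g x (x + w) y (y + h)|.
  by exists x, y; split => //; left.
have [k2|k2] := lerP q `|im_contour g x (x + w) (y + h) (y + h + h)|.
  by exists x, (y + h); split => //; [left|right].
have [k3|k3] := lerP q `|im_contour g (x + w) (x + w + w) y (y + h)|.
  by exists (x + w), y; split => //; [right|left].
exists (x + w), (y + h); split; [by right|by right|].
move: k1 k2 k3 Q; clear; lra.
Qed.

(** Bisection: otherwise there are nested rectangles on which the functional is
    at least a fixed multiple of the area, which contradicts [im_contour_small]
    at their common point. *)
Theorem goursat a b c d : a <= b -> c <= d -> diff_on_rect g a b c d ->
  im_contour g a b c d = 0.
Proof.
move=> ab cd H; apply: contrapT => /eqP J0.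
pose J := im_contour g; set eta := `|im_contour g a b c d|.
have eta0 : 0 < eta by rewrite normr_gt0.
pose w n := (b - a) * (1 / 2) ^+ n; pose h n := (d - c) * (1 / 2) ^+ n.
have w0 n : 0 <= w n by rewrite mulr_ge0 ?exprn_ge0 //; lra.
have h0 n : 0 <= h n by rewrite mulr_ge0 ?exprn_ge0 //; lra.
have wS n : w n = w n.+1 + w n.+1 by rewrite /w exprS; lra.
have hS n : h n = h n.+1 + h n.+1 by rewrite /h exprS; lra.
pose good n (p : R * R) := [/\ a <= p.1, p.1 + w n <= b, c <= p.2,
  p.2 + h n <= d & eta * (1 / 4) ^+ n <= `|J p.1 (p.1 + w n) p.2 (p.2 + h n)|].
pose next n (p p' : R * R) := [/\ good n.+1 p', p.1 <= p'.1,
  p'.1 + w n.+1 <= p.1 + w n, p.2 <= p'.2 & p'.2 + h n.+1 <= p.2 + h n].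
have step n p : good n p -> exists p', next n p p'.
  case: p => x y [/= h1 h2 h3 h4 h5].
  rewrite wS in h2; rewrite hS in h4.
  have w1 := w0 n.+1; have hh1 := h0 n.+1.
  have H' : diff_on_rect g x (x + w n.+1 + w n.+1) y (y + h n.+1 + h n.+1).
    by apply: diff_on_rectS H => //; rewrite -addrA.
  have h5' : 4 * (eta * (1 / 4) ^+ n.+1)
      <= `|J x (x + w n.+1 + w n.+1) y (y + h n.+1 + h n.+1)|.
    by move: h5; rewrite wS hS !addrA; apply: le_trans; rewrite exprS mulrCA; lra.
  have [x' [y' [Hx Hy Hq]]] := im_contour_pick w1 hh1 H' h5'.
  exists (x', y'); split => /=; rewrite ?(wS n) ?(hS n).
  - have [x1 x2] : x <= x' /\ x' + w n.+1 <= x + (w n.+1 + w n.+1).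
      by case: Hx => ->; split; lra.
    have [y1 y2] : y <= y' /\ y' + h n.+1 <= y + (h n.+1 + h n.+1).
      by case: Hy => ->; split; lra.
    split => //=; [exact: le_trans h1 x1|exact: le_trans x2 h2|
      exact: le_trans h3 y1|exact: le_trans y2 h4].
  - by case: Hx => ->; lra.
  - by case: Hx => ->; lra.
  - by case: Hy => ->; lra.
  - by case: Hy => ->; lra.
have good0 : good 0%N (a, c).
  split; rewrite /w /h /= ?expr0 ?mulr1; try lra.
  by rewrite [a + _]addrC subrK [c + _]addrC subrK.
pose nx n (p : {p | good n p}) : {p | good n.+1 p} :=
  let: exist p' Hp' := cid (step n (sval p) (svalP p)) in
  exist _ p' (let: And5 a1 _ _ _ _ := Hp' in a1).
have nxP n (p : {p | good n p}) : next n (sval p) (sval (nx n p)).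
  by rewrite /nx; case: cid.
pose s := fix s n : {p | good n p} :=
  if n is m.+1 then nx m (s m) else exist _ (a, c) good0.
pose X n := (sval (s n)).1; pose Y n := (sval (s n)).2.
have sg n : good n (X n, Y n) by have := svalP (s n); rewrite /X /Y; case: (sval (s n)).
have sS n : [/\ X n <= X n.+1, X n.+1 + w n.+1 <= X n + w n, Y n <= Y n.+1 &
  Y n.+1 + h n.+1 <= Y n + h n] by have [] := nxP n (s n).
have nest (Z W : nat -> R) : (forall n, 0 <= W n) -> (forall n, Z n <= Z n.+1) ->
    (forall n, Z n.+1 + W n.+1 <= Z n + W n) ->
    exists z, forall n, Z n <= z <= Z n + W n.
  move=> W0 Zi Zd.
  have mZ m n : (m <= n)%N -> Z m <= Z n.
    by move/subnK <-; elim: (n - m)%N => //= k IH; rewrite addSn; exact: le_trans (Zi _).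
  have mW m n : (m <= n)%N -> Z n + W n <= Z m + W m.
    by move/subnK <-; elim: (n - m)%N => //= k IH; rewrite addSn; exact: le_trans (Zd _) _.
  have ZW m n : Z m <= Z n + W n.
    have [mn|/ltnW nm] := leqP m n.
      by apply: le_trans (mZ _ _ mn) _; rewrite lerDl.
    by apply: le_trans (mW _ _ nm); rewrite lerDl.
  exists (sup (range Z)) => n; apply/andP; split.
    apply: ub_le_sup; last by exists n.
    by exists (Z 0%N + W 0%N) => _ [m _ <-].
  apply: ge_sup; first by exists (Z 0%N); exists 0%N.
  by move=> _ [m _ <-].
have [x Hx] : exists x, forall n, X n <= x <= X n + w n.
  by apply: nest => // n; have [] := sS n.
have [y Hy] : exists y, forall n, Y n <= y <= Y n + h n.
  by apply: nest => // n; have [] := sS n.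
set L := (b - a) + (d - c).
have e0 : 0 < eta / (2 * (L ^+ 2 + 1)).
  by rewrite divr_gt0 // mulr_gt0 // ltr_wpDl ?sqr_ge0.
have dxy : differentiable g (cx x y).
  apply: H.
    by have /andP[? ?] := Hx 0%N; have [/= ? ? _ _ _] := sg 0%N; apply/andP; split; lra.
  by have /andP[? ?] := Hy 0%N; have [/= _ _ ? ? _] := sg 0%N; apply/andP; split; lra.
have [r r0 Hr] := im_contour_small dxy e0.
have [n Hn] := half_exp_small L r0.
have [/= g1 g2 g3 g4 g5] := sg n.
have E : X n + w n - X n + (Y n + h n - Y n) = L * (1 / 2) ^+ n.
  by rewrite /w /h /L; lra.
have := Hr _ _ _ _ (Hx n) (Hy n); rewrite E => /(_ Hn (diff_on_rectS g1 g2 g3 g4 H)).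
move=> /(le_trans g5).
have -> : (L * (1 / 2) ^+ n) ^+ 2 = L ^+ 2 * (1 / 4) ^+ n.
  rewrite [LHS]exprMn; congr (_ * _).
  by rewrite -[LHS]exprM mulnC [LHS]exprM; congr (_ ^+ _); field.
have p4 : 0 < (1 / 4 : R) ^+ n by apply: exprn_gt0; lra.
rewrite mulrA ler_pM2r //.
rewrite mulrAC ler_pdivlMr ?mulr_gt0 // ?ltr_wpDl ?sqr_ge0 //.
have : 0 <= L ^+ 2 by exact: sqr_ge0.
by move=> l0; rewrite ler_pM2l //; lra.
Qed.

End goursat_thm.

(** * Maximum principle *)

(** The complex exponential.  Its two uses are that it is complex
    differentiable and that it turns circles into vertical segments. *)
Definition cexp (R : realType) (w : CC R) : CC R :=
  rc (expR (re w)) * cx (cos (im w)) (sin (im w)).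

Section cexp.
Variable R : realType.

Lemma real_approx (f : R -> R) (p e : R) : is_derive (0 : R) 1 f p -> 0 < e ->
  exists2 d : R, 0 < d & forall h, `|h| < d -> `|f h - f 0 - p * h| <= e * `|h|.
Proof.
move=> df e0.
have : h^-1 *: (f (h *: 1 + 0) - f 0) @[h --> 0^'] --> p.
  by have [+ <-] := df; exact.
move=> /cvgrPdist_lt /(_ e e0) /nbhs_ballP[d d0 Hd]; exists d => // h hd.
have [->|h0] := eqVneq h 0; first by rewrite subrr mulr0 subrr normr0 mulr0.
have := Hd h; rewrite /ball /= sub0r normrN => /(_ hd h0).
rewrite addr0 [h *: 1]mulr1 -[_ *: _]/(_ * _) => /ltW.
have nh : 0 < `|h| by rewrite normr_gt0.
rewrite distrC -(ler_pM2r nh) -normrM.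
by have -> : (h^-1 * (f h - f 0) - p) * h = f h - f 0 - p * h by field.
Qed.

Lemma cexpD z w : cexp (z + w) = cexp z * cexp w :> CC R.
Proof.
rewrite /cexp reD imD expRD cosD sinD; apply: cx_inj;
  rewrite !(reM, imM, re_rc, im_rc, re_cx, im_cx); ring.
Qed.

Lemma nc_cexp w : nc (cexp w : CC R) = expR (re w).
Proof.
rewrite /cexp ncM nc_rc ger0_norm ?expR_ge0 //.
suff -> : nc (cx (cos (im w)) (sin (im w))) = 1 by rewrite mulr1.
apply/eqP; rewrite -(@eqrXn2 _ 2) ?nc_ge0 // nc_sqr re_cx im_cx cos2Dsin2.
by rewrite expr1n.
Qed.

(** At 0 the expansion follows from those of the real exponential, cosine and
    sine; [cexpD] moves it to an arbitrary point. *)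
Lemma cexp_approx (e : R) : 0 < e -> exists2 d : R, 0 < d &
  forall h : CC R, nc h < d -> nc (cexp h - 1 - h) <= e * nc h.
Proof.
move=> e0.
have [e' [e'0 e'1 e'9]] : exists e' : R, [/\ 0 < e', e' <= 1 & e' <= e / 9].
  exists (Num.min 1 (e / 9)).
  by rewrite lt_min ltr01 divr_gt0 // !ge_min !lexx orbT.
have [d1 d10 H1] := real_approx (is_derive_expR 0) e'0.
have [d2 d20 H2] := real_approx (is_derive_cos 0) e'0.
have [d3 d30 H3] := real_approx (is_derive_sin 0) e'0.
exists (Num.min e' (Num.min d1 (Num.min d2 d3))).
  by rewrite !lt_min e'0 d10 d20 d30.
move=> h; rewrite !lt_min => /and4P[h0 h1 h2 h3].
have rh := re_le h; have ih := im_le h.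
have := H1 _ (le_lt_trans rh h1); have := H2 _ (le_lt_trans ih h2).
have := H3 _ (le_lt_trans ih h3).
rewrite expR0 cos0 sin0 oppr0 mul1r mul0r !subr0 mul1r.
set s := re h in rh *; set t := im h in ih *.
set A := expR s; set C := cos t; set S := sin t => hS hC hA.
apply: le_trans (nc_le _) _; rewrite !(reB, imB) /cexp.
rewrite !(reM, imM, re_rc, im_rc, re_cx, im_cx) -/s -/t -/A -/C -/S.
rewrite !mul0r !subr0 !addr0; rewrite addr0 in hS.
set n := nc h in rh ih h0 *; have n0 : 0 <= n by exact: nc_ge0.
have -> : A * C - 1 - s = (A - 1 - s) + A * (C - 1) by ring.
have -> : A * S - t = A * (S - t) + (A - 1) * t by ring.
have hA1 : `|A - 1 - s| <= e' * n by apply: le_trans hA _; rewrite ler_pM2l.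
have hS1 : `|S - t| <= e' * n by apply: le_trans hS _; rewrite ler_pM2l.
have hC1 : `|C - 1| <= e' * n by apply: le_trans hC _; rewrite ler_pM2l.
have e1n : e' * n <= n by rewrite ler_piMl.
have A1 : `|A - 1| <= 2 * n.
  have -> : A - 1 = (A - 1 - s) + s by ring.
  apply: le_trans (ler_normD _ _) _; lra.
have A3 : `|A| <= 3.
  have -> : A = (A - 1) + 1 by ring.
  apply: le_trans (ler_normD _ _) _; rewrite normr1; lra.
have B1 : `|A * (C - 1)| <= 3 * (e' * n) by rewrite normrM ler_pM.
have B2 : `|A * (S - t)| <= 3 * (e' * n) by rewrite normrM ler_pM.
have B3 : `|(A - 1) * t| <= 2 * n * e'.
  by rewrite normrM ler_pM // (le_trans ih) // ltW.
have := ler_normD (A - 1 - s) (A * (C - 1)).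
have := ler_normD (A * (S - t)) ((A - 1) * t).
have : e' * n <= e / 9 * n by rewrite ler_wpM2r.
lra.
Qed.

Lemma cexp_diff w : differentiable (@cexp R) w.
Proof.
apply/differentiableCP; exists (cexp w) => e e0.
have n0 : 0 < nc (cexp w) by rewrite nc_cexp expR_gt0.
have [d d0 Hd] := cexp_approx (divr_gt0 e0 n0).
exists d => // z /Hd H.
have -> : cexp z - cexp w - cexp w * (z - w) =
    cexp w * (cexp (z - w) - 1 - (z - w)) :> CC R.
  have -> : cexp z = cexp w * cexp (z - w) by rewrite -cexpD addrC subrK.
  by rewrite !mulrBr mulr1.
rewrite ncM mulrC -ler_pdivlMr //.
by apply: le_trans H _; rewrite mulrAC.
Qed.

Lemma cexp_periodic (x : R) : cexp (cx x 0) = cexp (cx x (pi + pi)).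
Proof. by rewrite /cexp !re_cx !im_cx cosDpi sinDpi cospi sinpi cos0 sin0 oppr0 opprK. Qed.

End cexp.

Section mean_value.
Variable R : realType.

(** By [goursat] for k(z0 + exp w), the mean of Re k over the circle of radius
    r equals the mean over an arbitrarily small circle, which is close to Re
    k(z0). *)
Lemma re_le_circle (k : CC R -> CC R) (z0 : CC R) (r M : R) : 0 < r ->
  (forall w, nc (w - z0) <= r -> differentiable k w) ->
  (forall w, nc (w - z0) = r -> re (k w) <= M) -> re (k z0) <= M.
Proof.
move=> r0 dk HM; rewrite leNgt; apply/negP => MK.
set eta := re (k z0) - M; have eta0 : 0 < eta by rewrite subr_gt0.
have /continuousCP : {for z0, continuous k}.
  by apply/differentiable_continuous/dk; rewrite subrr nc0 ltW.
move=> /(_ (eta / 2) ltac:(by rewrite divr_gt0)) [d d0 Hd].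
pose m := Num.min (d / 2) r.
have m0 : 0 < m by rewrite lt_min divr_gt0.
have mr : m <= r by rewrite ge_min lexx orbT.
have md : m < d by apply: (@le_lt_trans _ _ (d / 2)); rewrite ?ge_min ?lexx //; lra.
pose g w := k (z0 + cexp w).
have lnmr : ln m <= ln r by rewrite ler_ln.
have pp : (0 : R) <= pi + pi by have := pi_ge0 R; lra.
have dg : diff_on_rect g (ln m) (ln r) 0 (pi + pi).
  move=> x y /andP[_ xr] _.
  apply: differentiable_comp; last first.
    by apply: dk; rewrite addrC addKr nc_cexp re_cx -[leRHS]lnK // ler_expR.
  by apply: differentiableD; [exact: differentiable_cst|exact: cexp_diff].
have := goursat lnmr pp dg.
rewrite /im_contour.
have -> : segint (ln m) (ln r) (fun x => im (g (cx x 0)) - im (g (cx x (pi + pi)))) = 0.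
  rewrite -[RHS](mul0r (ln r - ln m)) -segint_cst //; congr (segint _ _ _).
  by apply/funext => x; rewrite /g cexp_periodic subrr.
rewrite addr0 => J0.
suff : segint 0 (pi + pi) (fun y => re (g (cx (ln r) y)) - re (g (cx (ln m) y)))
   <= (- (eta / 2)) * (pi + pi - 0).
  rewrite J0 subr0; have := pi_gt0 R; nra.
apply: segint_le => //.
  by apply: cont_onB; apply: cont_u dg _; rewrite lexx lnmr.
move=> y _.
have h1 : re (g (cx (ln r) y)) <= M.
  by apply: HM; rewrite addrC addKr nc_cexp re_cx lnK.
have h2 : re (k z0) - re (g (cx (ln m) y)) <= eta / 2.
  rewrite -reB; apply: le_trans (ler_norm _) _; apply: le_trans (re_le _) _.
  rewrite ncC ltW //; apply: Hd.
  by rewrite addrC addKr nc_cexp re_cx lnK.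
by rewrite /eta in h2 *; lra.
Qed.

Definition cj (z : CC R) : CC R := cx (re z) (- im z).

(** A point maximizing |f|^2 + e |z|^2 cannot be an interior point z0: there
    the function f(z) cj(f z0) + e cj(z0) (z - z0) would have real part at most
    |f z0|^2 - e r^2 / 2 on a small circle, although its value at the centre is
    |f z0|^2.  Then e tends to 0. *)
Theorem max_principle (C S : set (CC R)) (f : CC R -> CC R) (b : R) : 0 <= b ->
  compact C -> (forall z, C z -> differentiable f z) ->
  (forall z, C z -> ~ S z -> exists2 r : R, 0 < r & forall w, nc (w - z) <= r -> C w) ->
  (forall z, C z -> S z -> nc (f z) <= b) -> forall z, C z -> nc (f z) <= b.
Proof.
move=> b0 cC df CS fS z1 Cz1.
have contsq (h : CC R -> CC R) z : {for z, continuous h} ->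
    {for z, continuous (fun w => nc (h w) ^+ 2)}.
  move=> /continuousCP H.
  have nch : {for z, continuous (fun w => nc (h w))}.
    move=> A /nbhs_ballP[e e0 HA].
    have [d d0 Hd] := H e e0; apply/nbhsCP; exists d => // w /Hd hw; apply: HA.
    rewrite /ball /= ltr_norml; have := ncBD (h z) (h w); have := ncBD (h w) (h z).
    rewrite (ncC (h z)) => *; apply/andP; split; lra.
  exact: (continuousM nch nch).
pose phi e w := nc (f w) ^+ 2 + e * nc w ^+ 2.
have cphi e : {within C, continuous (phi e)}.
  apply: continuous_in_subspaceT => z; rewrite inE => Cz.
  have h1 := contsq f z (differentiable_continuous (df z Cz)).
  have h2 := contsq id z (@cvg_id _ _).
  have h3 : {for z, continuous (fun=> e : R)} by exact: cst_continuous.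
  exact: (continuousD h1 (continuousM h3 h2)).
have [K HK] : exists K : R, forall z, C z -> nc z ^+ 2 <= K.
  have c2 : {within C, continuous (fun z : CC R => nc z ^+ 2)}.
    apply: continuous_in_subspaceT => z _.
    exact: (contsq id z (@cvg_id _ _)).
  have [c _ Hc] := compact_EVT_max (ex_intro _ z1 Cz1) cC c2.
  by exists (nc c ^+ 2) => z Cz; apply: Hc; rewrite inE.
have K0 : 0 <= K by apply: le_trans (HK _ Cz1); rewrite sqr_ge0.
suff H e : 0 < e -> nc (f z1) ^+ 2 <= b ^+ 2 + e * K.
  rewrite -(ler_pXn2r (n := 2)) ?nnegrE ?nc_ge0 //.
  apply/ler_addgt0Pr => e e0.
  have := H (e / (K + 1)) ltac:(by rewrite divr_gt0 // ltr_wpDl).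
  move=> /le_trans -> //; rewrite lerD2l mulrAC ler_pdivrMr ?ltr_wpDl //.
  by rewrite ler_pM2l // lerDl.
move=> e0.
have [z0] := compact_EVT_max (ex_intro _ z1 Cz1) cC (cphi e).
rewrite inE => Cz0 max0.
have {}max0 w : C w -> phi e w <= phi e z0 by move=> Cw; apply: max0; rewrite inE.
have [Sz0|nS] := pselect (S z0).
  apply: (@le_trans _ _ (phi e z1)).
    by rewrite /phi lerDl mulr_ge0 ?sqr_ge0 // ltW.
  apply: le_trans (max0 _ Cz1) _; rewrite /phi lerD //.
    by rewrite ler_pXn2r ?nnegrE ?nc_ge0 // fS.
  by rewrite ler_pM2l // HK.
have [r r0 Hr] := CS _ Cz0 nS.
pose k w := f w * cj (f z0) + rc e * cj z0 * (w - z0).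
have kz0 : re (k z0) = nc (f z0) ^+ 2.
  rewrite /k subrr mulr0 addr0 reM re_cx im_cx nc_sqr; ring.
have dk w : nc (w - z0) <= r -> differentiable k w.
  move=> /Hr Cw; apply: differentiableD.
    by apply: differentiableM; [exact: df|exact: differentiable_cst].
  apply: differentiableM; first exact: differentiable_cst.
  by apply: differentiableB; [exact: dif_id|exact: differentiable_cst].
have := re_le_circle r0 dk; move=> /(_ (nc (f z0) ^+ 2 - e * r ^+ 2 / 2)).
rewrite kz0 => H.
suff : nc (f z0) ^+ 2 <= nc (f z0) ^+ 2 - e * r ^+ 2 / 2.
  by have : 0 < e * r ^+ 2 by [rewrite mulr_gt0 ?exprn_gt0]; lra.
apply: H => w wr; have Cw : C w by apply: Hr; rewrite wr.
have := max0 w Cw; rewrite /phi.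
have E1 : r ^+ 2 = (re w - re z0) ^+ 2 + (im w - im z0) ^+ 2.
  by rewrite -wr nc_sqr reB imB.
rewrite /k !(reD, reM, imM, reB, imB, re_rc, im_rc, re_cx, im_cx) !nc_sqr E1 => mx.
set a1 := re (f w) in mx *; set a2 := im (f w) in mx *.
set c1 := re (f z0) in mx *; set c2 := im (f z0) in mx *.
have q1 : 0 <= (a1 - c1) ^+ 2 by exact: sqr_ge0.
have q2 : 0 <= (a2 - c2) ^+ 2 by exact: sqr_ge0.
nra.
Qed.

End mean_value.

(** * Discs, annuli and a branch of the square root *)

Section compactness.
Variable R : realType.

Lemma nc_continuous : continuous (@nc R).
Proof.
move=> z A /nbhs_ballP[e e0 HA]; apply/nbhsCP; exists e => // w hw; apply: HA.
rewrite /ball /= ltr_norml; have := ncBD z w; have := ncBD w z.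
rewrite (ncC z) => *; apply/andP; split; lra.
Qed.

Lemma cx_continuous : continuous (fun p : R * R => cx p.1 p.2).
Proof.
move=> [x y] A /nbhsCP[e e0 HA].
exists (ball x (e / 2), ball y (e / 2)).
  by split => /=; apply: nbhsx_ballx; rewrite divr_gt0.
move=> [x' y'] [/= h1 h2]; apply: HA; rewrite ncC.
apply: le_lt_trans (nc_le _) _; rewrite cxB re_cx im_cx.
by move: h1 h2; rewrite /ball /= => h1 h2; lra.
Qed.

Lemma closed_nc_le (r : R) : closed [set z : CC R | nc z <= r].
Proof.
apply: (@closed_comp _ _ (@nc R) [set x | x <= r]) => [z _|].
  exact: nc_continuous.
exact: closed_le.
Qed.

Lemma closed_nc_ge (r : R) : closed [set z : CC R | r <= nc z].
Proof.
apply: (@closed_comp _ _ (@nc R) [set x | r <= x]) => [z _|].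
  exact: nc_continuous.
exact: closed_ge.
Qed.

Lemma compact_disc (r : R) : compact [set z : CC R | nc z <= r].
Proof.
have c1 : compact ((fun p : R * R => cx p.1 p.2) @` (`[- r, r] `*` `[- r, r])).
  apply: continuous_compact.
    by apply: continuous_subspaceT; exact: cx_continuous.
  by apply: compact_setX; exact: segment_compact.
apply: subclosed_compact c1 _; first exact: closed_nc_le.
move=> z /= zr; exists (re z, im z); last by rewrite /= cxE.
by rewrite /= !in_itv /= -!ler_norml !(le_trans (re_le z), le_trans (im_le z)).
Qed.

Definition annulus (e r : R) : set (CC R) := [set z | e <= nc z <= r].

Lemma compact_annulus e r : compact (annulus e r).
Proof.
apply: subclosed_compact (@compact_disc r) _.
  have -> : annulus e r = [set z | e <= nc z] `&` [set z | nc z <= r].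
    by apply/seteqP; split => z /=; [move/andP|move=> [? ?]; apply/andP].
  apply: closedI; [exact: closed_nc_ge|exact: closed_nc_le].
by move=> z /= /andP[].
Qed.

Lemma disc_max (r b : R) (f : CC R -> CC R) : 0 <= b ->
  (forall z, nc z <= r -> differentiable f z) ->
  (forall z, nc z = r -> nc (f z) <= b) -> forall z, nc z <= r -> nc (f z) <= b.
Proof.
move=> b0 df fb.
apply: (max_principle (S := [set z | nc z = r]) b0 (@compact_disc r)) => //.
  move=> z /= zr /eqP; rewrite eq_le zr /= -ltNge => {}zr.
  exists (r - nc z); first by rewrite subr_gt0.
  by move=> w hw; have := ncBD w z; lra.
by move=> z /= _; exact: fb.
Qed.

Lemma annulus_max (e r b : R) (f : CC R -> CC R) : 0 <= b ->
  (forall z, annulus e r z -> differentiable f z) ->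
  (forall z, nc z = e -> nc (f z) <= b) ->
  (forall z, nc z = r -> nc (f z) <= b) ->
  forall z, annulus e r z -> nc (f z) <= b.
Proof.
move=> b0 df fe fr.
apply: (max_principle (S := [set z | nc z = e \/ nc z = r]) b0
  (@compact_annulus e r)) => //.
  move=> z /= /andP[ez zr] /not_orP[/eqP h1 /eqP h2].
  have {}h1 : e < nc z by rewrite lt_neqAle ez eq_sym h1.
  have {}h2 : nc z < r by rewrite lt_neqAle zr h2.
  exists (Num.min (nc z - e) (r - nc z)); first by rewrite lt_min !subr_gt0 h1 h2.
  move=> w; rewrite le_min => /andP[w1 w2].
  have := ncBD w z; have := ncBD z w; rewrite (ncC z) => *; apply/andP; split; lra.
by move=> z /= _ [/fe|/fr].
Qed.

End compactness.

(** On Re z <= 1/4 this is the square root of 1 - 4 z with nonnegative real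
    part; replacing the real part of 1 - 4 z by its positive part makes it
    continuous on the whole plane. *)
Definition csq (R : realType) (z : CC R) : CC R :=
  sqrtc (cx (Num.max (re (1 - 4 * z)) 0) (im (1 - 4 * z))).

Section csq.
Variable R : realType.
Implicit Types z w : CC R.

Lemma re_csq_ge0 z : 0 <= re (csq z).
Proof. by rewrite /csq /cx /= sqrtr_ge0. Qed.

Lemma csq_sqr' z :
  csq z ^+ 2 = cx (Num.max (re (1 - 4 * z)) 0) (im (1 - 4 * z)).
Proof. exact: sqr_sqrtc. Qed.

Lemma re14 z : re (1 - 4 * z) = 1 - 4 * re z.
Proof. by rewrite reB reM !(re1, im1); case: z => a b /=; ring. Qed.
Lemma im14 z : im (1 - 4 * z) = - (4 * im z).
Proof. by rewrite imB imM; case: z => a b /=; ring. Qed.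

Lemma csq_sqr z : re z <= 1 / 4 -> csq z ^+ 2 = 1 - 4 * z.
Proof.
move=> h; rewrite csq_sqr' -[RHS]cxE; congr cx; apply/max_idPl.
rewrite re14; lra.
Qed.

Lemma re_sqr z : re (z ^+ 2) = re z ^+ 2 - im z ^+ 2.
Proof. by rewrite expr2 reM. Qed.

(** The square has nonnegative real part. *)
Lemma csq_cone z : `|im (csq z)| <= re (csq z).
Proof.
rewrite -(ler_pXn2r (n := 2)) ?nnegrE ?re_csq_ge0 // real_normK ?num_real //.
rewrite -subr_ge0 -re_sqr csq_sqr' re_cx le_max lexx orbT //.
Qed.

Lemma re_csq_gt0 z : re z < 1 / 4 -> 0 < re (csq z).
Proof.
move=> h; rewrite lt_neqAle re_csq_ge0 andbT; apply/eqP => E.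
have := csq_sqr (ltW h); move/(congr1 (@re R)); rewrite re_sqr -E re14.
have := sqr_ge0 (im (csq z)); lra.
Qed.

Lemma max0_lip (x y : R) : `|Num.max x 0 - Num.max y 0| <= `|x - y|.
Proof.
have h1 := ler_norm (x - y); have h2 := ler_norm (y - x); rewrite distrC in h2.
rewrite ler_norml; case: (lerP 0 x) => hx; case: (lerP 0 y) => hy; apply/andP; split; lra.
Qed.

(** Two elements s, t of the cone |Im| <= Re satisfy |s - t| <= |s + t|, hence
    |s - t|^2 <= |s^2 - t^2|. *)
Lemma csq_holder z w : nc (csq z - csq w) ^+ 2 <= 4 * nc (z - w).
Proof.
set s := csq z; set t := csq w.
have st : nc (s - t) <= nc (s + t).
  rewrite -(ler_pXn2r (n := 2)) ?nnegrE ?nc_ge0 // !nc_sqr reB reD imB imD.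
  have := csq_cone z; have := csq_cone w; rewrite -/s -/t !ler_norml.
  move=> /andP[h1 h2] /andP[h3 h4].
  have : 0 <= (re s - im s) * (re t - im t) by apply: mulr_ge0; lra.
  have : 0 <= (re s + im s) * (re t + im t) by apply: mulr_ge0; lra.
  nra.
have : nc (s - t) ^+ 2 <= nc (s ^+ 2 - t ^+ 2).
  by rewrite subr_sqr ncM expr2 ler_wpM2l // nc_ge0.
move=> /le_trans; apply.
rewrite /s /t !csq_sqr' cxB !re14 !im14.
rewrite -(ler_pXn2r (n := 2)) ?nnegrE ?nc_ge0 ?mulr_ge0 // ?nc_ge0 //.
rewrite exprMn !nc_sqr re_cx im_cx reB imB mulrDr; apply: lerD; last by nra.
rewrite -real_normK ?num_real // -exprMn -[leRHS]real_normK ?num_real //.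
rewrite ler_pXn2r ?nnegrE //.
have -> : 4 * (re z - re w) = (1 - 4 * re w) - (1 - 4 * re z) by ring.
by rewrite [leRHS]distrC; exact: max0_lip.
Qed.

Lemma csq_continuous : continuous (@csq R).
Proof.
move=> z; apply/continuousCP => e e0; exists (e ^+ 2 / 4).
  by rewrite divr_gt0 ?exprn_gt0.
move=> w hw; rewrite -(ltr_pXn2r (n := 2)) ?nnegrE ?nc_ge0 ?ltW //.
apply: le_lt_trans (csq_holder _ _) _; lra.
Qed.

Lemma csq_diff z : re z < 1 / 4 -> differentiable (@csq R) z.
Proof.
move=> hz; have t0 := re_csq_gt0 hz; set t := csq z in t0.
have tn : re t <= nc t by apply: le_trans (ler_norm _) (re_le _).
have tnz : t != 0 by rewrite -nc_gt0; lra.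
(* the derivative of the square root of 1 - 4 z *)
apply/differentiableCP; exists (- (2 / t)) => e e0.
have /continuousCP /(_ (e * re t ^+ 2 / 2)) := @csq_continuous z.
move=> [|d d0 Hd]; first by rewrite divr_gt0 // mulr_gt0 // exprn_gt0.
exists (Num.min d (1 / 4 - re z)); first by rewrite lt_min d0 subr_gt0.
move=> w; rewrite lt_min => /andP[wd wz].
have {wd Hd} := Hd _ wd; rewrite -/t => Hd.
have wr : re w <= 1 / 4.
  have := le_trans (ler_norm _) (re_le (w - z)); rewrite reB; lra.
rewrite -/t; set s := csq w in Hd *.
have stn : re t <= nc (s + t).
  apply: le_trans (le_trans (ler_norm _) (re_le _)).
  by rewrite reD lerDr re_csq_ge0.
have stz : s + t != 0 by rewrite -nc_gt0; lra.
have E : w - z = - ((s - t) * (s + t)) / 4.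
  by rewrite -subr_sqr (csq_sqr wr) (csq_sqr (ltW hz)); field.
have -> : s - t - - (2 / t) * (w - z) = (w - z) * (2 * (s - t) / ((s + t) * t)).
  by rewrite E; field; rewrite tnz stz.
rewrite ncM mulrC ler_wpM2r ?nc_ge0 //.
rewrite ncM ncV [nc (_ * t)]ncM ncM.
have -> : nc (2 : CC R) = 2 by exact: nc_nat.
have p0 : 0 < nc (s + t) * nc t by rewrite mulr_gt0 //; lra.
rewrite ler_pdivrMr //.
have h1 : e * re t ^+ 2 <= e * (nc (s + t) * nc t).
  by rewrite ler_pM2l // expr2 ler_pM // ltW.
lra.
Qed.

End csq.

(** * Hulls in a fibre *)

Section local.
Variable R : realType.
Implicit Types f g : CC R -> CC R.

Lemma dif_near f g z : (exists2 d : R, 0 < d & forall w, nc (w - z) < d -> f w = g w) ->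
  differentiable g z -> differentiable f z.
Proof.
case=> d d0 Hd /differentiableCP[p Hp]; apply/differentiableCP; exists p => e e0.
have [d' d'0 Hd'] := Hp e e0.
exists (Num.min d d'); first by rewrite lt_min d0.
move=> w; rewrite lt_min => /andP[h1 h2].
by rewrite Hd // Hd ?subrr ?nc0 //; exact: Hd'.
Qed.

(** The product vanishes at z, and its difference quotient is that of the first
    factor times a continuous function. *)
Lemma dif_mul0 f g z : differentiable f z -> f z = 0 -> {for z, continuous g} ->
  differentiable (fun w => f w * g w) z.
Proof.
move=> /differentiableCP[p Hp] fz /continuousCP cg; apply/differentiableCP; exists (p * g z) => e e0.
set K := nc p + 1; have K0 : 0 < K by rewrite ltr_wpDl ?nc_ge0.
have [d1 d10 H1] := cg (e / 2 / K) ltac:(by rewrite !divr_gt0).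
have G0 : 0 < nc (g z) + 1 by rewrite ltr_wpDl ?nc_ge0.
have [d2 d20 H2] := Hp (Num.min 1 (e / 2 / (nc (g z) + 1)))
  ltac:(by rewrite lt_min ltr01 !divr_gt0).
exists (Num.min d1 d2); first by rewrite lt_min d10.
move=> w; rewrite lt_min => /andP[{}/H1 h1 {}/H2]; rewrite fz mul0r !subr0 => h2.
have -> : f w * g w - p * g z * (w - z) =
   f w * (g w - g z) + (f w - p * (w - z)) * g z by ring.
apply: le_trans (ncD _ _) _; rewrite !ncM.
have n0 := nc_ge0 (w - z).
have h3 : nc (f w) <= K * nc (w - z).
  have -> : f w = p * (w - z) + (f w - p * (w - z)) by ring.
  apply: le_trans (ncD _ _) _; rewrite ncM /K mulrDl lerD2l mul1r.
  by apply: le_trans h2 _; rewrite ler_piMl // ge_min lexx.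
have B1 : nc (f w) * nc (g w - g z) <= (K * nc (w - z)) * (e / 2 / K).
  by rewrite ler_pM ?nc_ge0 // ltW.
have B2 : nc (f w - p * (w - z)) * nc (g z) <= e / 2 * nc (w - z).
  apply: (@le_trans _ _ (e / 2 / (nc (g z) + 1) * nc (w - z) * nc (g z))).
    rewrite ler_wpM2r ?nc_ge0 //; apply: le_trans h2 _.
    by rewrite ler_wpM2r // ge_min lexx orbT.
  rewrite mulrAC ler_wpM2r // mulrAC ler_pdivrMr // ler_pM2l ?divr_gt0 //.
  by rewrite lerDl.
have E : K * nc (w - z) * (e / 2 / K) = e / 2 * nc (w - z) by field; rewrite gt_eqF.
rewrite E in B1; lra.
Qed.

Lemma bernoulli (t : R) n : 0 <= t -> 1 + t *+ n <= (1 + t) ^+ n.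
Proof.
move=> t0; elim: n => [|n IH]; first by rewrite mulr0n addr0 expr0.
rewrite exprS mulrDl mul1r mulrS addrCA addrC; apply: lerD => //.
rewrite ler_peMr //; apply: le_trans IH; rewrite lerDl mulrn_wge0 //.
Qed.

Lemma expr_unbounded (q K : R) : 1 < q -> exists n, K < q ^+ n.
Proof.
move=> q1; have t0 : 0 < q - 1 by rewrite subr_gt0.
have Hn := archi_boundP (normr_ge0 (K / (q - 1))).
exists (Num.bound `|K / (q - 1)|); move: Hn; set n := Num.bound _ => Hn.
have {}Hn : K / (q - 1) < n%:R := le_lt_trans (ler_norm _) Hn.
have -> : q = 1 + (q - 1) by ring.
apply: lt_le_trans (bernoulli _ (ltW t0)).
rewrite ltr_pdivrMr // in Hn; rewrite -mulr_natl; lra.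
Qed.

Lemma root_bound (X K b : R) : 0 <= b -> (forall n, X ^+ n <= K * b ^+ n) -> X <= b.
Proof.
move=> b0 H; rewrite leNgt; apply/negP => bX.
have [b0'|bpos] := eqVneq b 0.
  by have := H 1%N; rewrite b0' !expr1 mulr0 leNgt -b0' bX.
have {}bpos : 0 < b by rewrite lt_neqAle eq_sym bpos.
have [n Hn] : exists n, K < (X / b) ^+ n by apply: expr_unbounded; rewrite ltr_pdivlMr // mul1r.
have := H n; rewrite leNgt -ltr_pdivlMr ?exprn_gt0 // => /negP; apply.
by rewrite -expr_div_n.
Qed.

(** The powers u^n and v^n are the roots of a quadratic equation whose
    coefficients, the sum and the product of these powers, are bounded by
    multiples of b^n and b^(2n).  So |u|^n is at most a constant times b^n for
    every n. *)
Lemma powersum_bound (u v : CC R) (K b : R) : 0 <= b ->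
  (forall n, nc (u ^+ n + v ^+ n) <= K * b ^+ n) -> nc u <= b.
Proof.
move=> b0 H.
have K0 : 0 <= K by have := le_trans (nc_ge0 _) (H 0%N); rewrite expr0 mulr1.
apply: (@root_bound _ (K ^+ 2 + K + K + 1)) => // n.
rewrite -ncX; set U := u ^+ n; set V := v ^+ n; set B := b ^+ n.
have B0 : 0 <= B by rewrite exprn_ge0.
have h1 : nc (U + V) <= K * B by exact: H.
have h2 : nc (U ^+ 2 + V ^+ 2) <= K * B ^+ 2.
  by rewrite /U /V /B -!exprM; exact: H.
have h3 : nc (U * V) <= (K ^+ 2 + K) * B ^+ 2.
  have -> : U * V = ((U + V) ^+ 2 - (U ^+ 2 + V ^+ 2)) / 2 by field.
  rewrite ncM ncV; have -> : nc (2 : CC R) = 2 by exact: nc_nat.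
  have := ncB ((U + V) ^+ 2) (U ^+ 2 + V ^+ 2).
  have : nc ((U + V) ^+ 2) <= K ^+ 2 * B ^+ 2.
    by rewrite ncX -exprMn ler_pXn2r ?nnegrE ?nc_ge0 // mulr_ge0.
  have := nc_ge0 ((U + V) ^+ 2 - (U ^+ 2 + V ^+ 2)).
  nra.
have h4 : nc U ^+ 2 <= K * B * nc U + (K ^+ 2 + K) * B ^+ 2.
  rewrite -ncX; have -> : U ^+ 2 = (U + V) * U - U * V by ring.
  apply: le_trans (ncB _ _) _; apply: lerD => //.
  by rewrite ncM ler_wpM2r // nc_ge0.
rewrite leNgt; apply/negP => h5.
have U0 := nc_ge0 U; have K2 := sqr_ge0 K.
have h6 : B <= nc U by nra.
have h7 : (K ^+ 2 + K) * B ^+ 2 <= (K ^+ 2 + K) * B * nc U.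
  by rewrite expr2 mulrA ler_wpM2l // !mulr_ge0 // addr_ge0.
have h8 : 0 < nc U by apply: le_lt_trans h5; rewrite mulr_ge0 // !addr_ge0.
have h9 : nc U * nc U <= (K * B + (K ^+ 2 + K) * B) * nc U.
  by rewrite mulrDl -expr2; apply: le_trans h4 _; rewrite lerD2l.
rewrite ler_pM2r // in h9; nra.
Qed.

End local.

Section fiber_hull.
Variables (R : realType) (h : CC R * CC R -> CC R) (b : R).
Hypotheses (dh : forall p, differentiable h p) (b0 : 0 <= b).

Lemma dif_h2 (f g : CC R -> CC R) z : differentiable f z -> differentiable g z ->
  differentiable (fun w => h (f w, g w)) z.
Proof.
move=> df dg; apply: (@differentiable_comp _ _ _ _ (fun w => (f w, g w)) h) => //.
exact: differentiable_pair.
Qed.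

(** A point outside the two polydiscs lies on a hyperbola x y = p, and the part
    of it with 1/2 <= |x| <= 2 |p| has its boundary in them. *)
Lemma hyper_hull (Y T : R) : 1 <= T -> 2 * T ^+ 2 <= Y ->
  (forall x y, nc x <= 1 / 2 -> nc y <= Y -> nc (h (x, y)) <= b) ->
  (forall x y, nc x <= Y -> nc y <= 1 / 2 -> nc (h (x, y)) <= b) ->
  forall x y, nc x <= T -> nc y <= T -> nc (h (x, y)) <= b.
Proof.
move=> T1 TY Hx Hy x y xT yT.
have TT : T <= Y by nra.
have [x1|x1] := lerP (nc x) (1 / 2); first by apply: Hx => //; lra.
have [y1|y1] := lerP (nc y) (1 / 2); first by apply: Hy => //; lra.
have xnz : x != 0 by rewrite -nc_gt0; lra.
have ynz : y != 0 by rewrite -nc_gt0; lra.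
pose f t := h (t, x * y / t).
have -> : h (x, y) = f x by rewrite /f mulrAC divff // mul1r.
have pT : nc x * nc y <= T ^+ 2 by rewrite expr2 ler_pM // nc_ge0.
apply: (@annulus_max R (1 / 2) (2 * (nc x * nc y)) b f b0).
- move=> t /andP[t1 _]; have tnz : t != 0 by rewrite -nc_gt0; lra.
  apply: dif_h2; first exact: dif_id.
  by apply: differentiableM; [exact: differentiable_cst|exact: differentiable_Rinv].
- move=> t t1; apply: Hx; rewrite ?t1 // !ncM ncV t1; lra.
- move=> t t1; have p0 : 0 < nc x * nc y by rewrite mulr_gt0; lra.
  apply: Hy; rewrite ?t1 ?(ncM, ncV, t1); first lra.
  by rewrite ler_pdivrMr ?mulr_gt0 //; lra.
- rewrite /annulus /=; apply/andP; split; nra.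
Qed.

(** The maximum principle on large annuli, for (k(z) - k(0))^2 / z: this
    function tends to 0 both at the origin and at infinity. *)
Lemma liouville (k : CC R -> CC R) : (forall z, differentiable k z) ->
  (forall z, nc (k z) <= b) -> k 1 = k 0.
Proof.
move=> dk kb; apply/eqP; rewrite -subr_eq0 -nc_eq0 -sqrf_eq0.
rewrite eq_le sqr_ge0 andbT; apply/ler_addgt0Pr => e e0; rewrite add0r.
have /differentiableCP[p /(_ 1 ltr01)[d0 d00 Hd]] := dk 0.
set P := nc p + 1; have P0 : 0 < P by rewrite ltr_wpDl ?nc_ge0.
have k0 w : nc w < d0 -> nc (k w - k 0) <= P * nc w.
  move=> wd; have := Hd w; rewrite subr0 mul1r => /(_ wd) h1.
  have -> : k w - k 0 = p * w + (k w - k 0 - p * w) by ring.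
  by apply: le_trans (ncD _ _) _; rewrite ncM /P mulrDl mul1r lerD2l.
pose d := Num.min (Num.min (d0 / 2) 1) (e / P ^+ 2).
have d_gt0 : 0 < d by rewrite !lt_min ltr01 !divr_gt0 ?exprn_gt0.
have dd0 : d < d0.
  by apply: (@le_lt_trans _ _ (d0 / 2)); rewrite ?ge_min ?lexx //; lra.
have d1 : d <= 1 by rewrite !ge_min lexx orbT.
have de : d <= e / P ^+ 2 by rewrite ge_min lexx orbT.
pose r := 1 + (2 * b) ^+ 2 / e.
have q0 : 0 <= (2 * b) ^+ 2 / e by rewrite divr_ge0 ?sqr_ge0 // ltW.
pose f z := (k z - k 0) ^+ 2 / z.
have : nc (f 1) <= e.
  apply: (@annulus_max R d r e f (ltW e0)).
  - move=> t /andP[t1 _]; have tnz : t != 0 by rewrite -nc_gt0; lra.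
    apply: differentiableM; last exact: differentiable_Rinv.
    apply: dif_X; apply: differentiableB; first exact: dk.
    exact: differentiable_cst.
  - move=> t t1; rewrite /f ncM ncV ncX t1 ler_pdivrMr //.
    have : nc (k t - k 0) <= P * d by rewrite -t1; apply: k0; rewrite t1.
    rewrite -(ler_pXn2r (n := 2)) ?nnegrE ?nc_ge0 ?mulr_ge0 ?(ltW P0) ?(ltW d_gt0) // => /le_trans; apply.
    rewrite exprMn; rewrite ler_pdivlMr ?exprn_gt0 // in de.
    by rewrite [d ^+ 2]expr2 mulrA ler_pM2r // mulrC.
  - move=> t t1; rewrite /f ncM ncV ncX t1.
    have r0 : 0 < r by rewrite /r; lra.
    rewrite ler_pdivrMr //.
    have : nc (k t - k 0) <= 2 * b.
      by apply: le_trans (ncB _ _) _; have := kb t; have := kb 0; lra.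
    rewrite -(ler_pXn2r (n := 2)) ?nnegrE ?nc_ge0 ?mulr_ge0 // => /le_trans; apply.
    by rewrite /r mulrDr mulr1 mulrCA divff ?gt_eqF // mulr1 lerDr ltW.
  - by apply/andP; rewrite nc1; split; rewrite // /r lerDl.
by rewrite /f divr1 ncX.
Qed.

Lemma sqrtc_cvg0 (D : CC R -> CC R) z : {for z, continuous D} -> D z = 0 ->
  {for z, continuous (fun w => sqrtc (D w) : CC R)}.
Proof.
move=> /continuousCP cD Dz; apply/continuousCP => e e0.
have [d d0 Hd] := cD (e ^+ 2) ltac:(by rewrite exprn_gt0).
exists d => // w /Hd; rewrite Dz sqrtc0 !subr0 => hw.
rewrite -(ltr_pXn2r (n := 2)) ?nnegrE ?nc_ge0 ?ltW // -ncX.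
by have -> : (sqrtc (D w) : CC R) ^+ 2 = D w by exact: sqr_sqrtc.
Qed.

Lemma cont_h2 (f g : CC R -> CC R) z : {for z, continuous f} -> {for z, continuous g} ->
  {for z, continuous (fun w => h (f w, g w))}.
Proof.
move=> cf cg; apply: (@continuous_comp _ _ _ (fun w => (f w, g w)) h).
  exact: (cvg_pair cf cg).
exact: differentiable_continuous.
Qed.

Lemma cont_X (f : CC R -> CC R) n z : {for z, continuous f} ->
  {for z, continuous (fun w => f w ^+ n)}.
Proof.
move=> cf; have dX : differentiable (fun u : CC R => u ^+ n) (f z).
  by apply: dif_X; exact: dif_id.
exact: (continuous_comp cf (differentiable_continuous dX)).
Qed.

(** The curve y^2 - kap x^d y = c is a double cover of the x-plane, branched
    where [D] vanishes.  The sum of the n-th powers of [h] over the two sheets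
    does not depend on the choice of the square root of [D] and is continuous;
    the factor [D] makes it differentiable at the branch points too. *)
Section quadratic_curve.
Variables (kap c : CC R) (d n : nat).
Let D x := kap ^+ 2 * x ^+ (2 * d) + 4 * c.
Let rt (s : CC R) x := (kap * x ^+ d + s) / 2.
Let G x := D x * (h (x, rt (sqrtc (D x)) x) ^+ n + h (x, rt (- sqrtc (D x)) x) ^+ n).

Lemma D_diff x : differentiable D x.
Proof.
apply: differentiableD; last exact: differentiable_cst.
apply: differentiableM; first exact: differentiable_cst.
by apply: dif_X; exact: dif_id.
Qed.

Lemma rt_diff (s : CC R -> CC R) x : differentiable s x ->
  differentiable (fun w => h (w, rt (s w) w) ^+ n) x.
Proof.
move=> ds; apply: dif_X; apply: dif_h2; first exact: dif_id.
apply: differentiableM; last exact: differentiable_cst.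
apply: differentiableD => //.
apply: differentiableM; first exact: differentiable_cst.
by apply: dif_X; exact: dif_id.
Qed.

Lemma rt_cont (s : CC R -> CC R) x : {for x, continuous s} ->
  {for x, continuous (fun w => h (w, rt (s w) w) ^+ n)}.
Proof.
move=> cs.
have cp : {for x, continuous (fun w : CC R => kap * w ^+ d)}.
  apply/differentiable_continuous.
  apply: differentiableM; first exact: differentiable_cst.
  by apply: dif_X; exact: dif_id.
have ct : {for x, continuous (fun=> 2^-1 : CC R)} by exact: cst_continuous.
have crt : {for x, continuous (fun w => rt (s w) w)}.
  exact: (continuousM (continuousD cp cs) ct).
have ch := cont_h2 (@cvg_id _ _ : {for x, continuous (fun w => w)}) crt.
exact: cont_X.
Qed.

(** Away from the zeros of [D], the square root is replaced by a differentiable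
    branch built from [csq]; the two branches occur symmetrically.  At a zero
    of [D], [dif_mul0] applies. *)
Lemma G_diff x : differentiable G x.
Proof.
have [Dx|Dx] := eqVneq (D x) 0.
  apply: (@dif_mul0 _ D); [exact: D_diff|exact: Dx|].
  have cs : {for x, continuous (fun w => sqrtc (D w) : CC R)}.
    by apply: sqrtc_cvg0 => //; exact/differentiable_continuous/D_diff.
  apply: continuousD; first exact: rt_cont.
  by apply: (@rt_cont (fun w => - sqrtc (D w))); exact: continuousN.
set s0 : CC R := sqrtc (D x).
pose r w : CC R := s0 * csq ((1 - D w / D x) / 4).
have dr : differentiable r x.
  apply: differentiableM; first exact: differentiable_cst.
  apply: (@differentiable_comp _ _ _ _ (fun w => (1 - D w / D x) / 4) (@csq R)).
    apply: differentiableM; last exact: differentiable_cst.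
    apply: differentiableB; first exact: differentiable_cst.
    by apply: differentiableM; [exact: D_diff|exact: differentiable_cst].
  apply: csq_diff; rewrite divff // subrr mul0r; have -> : re (0 : CC R) = 0 by [].
  lra.
apply: (@dif_near _ _ (fun w => D w * (h (w, rt (r w) w) ^+ n + h (w, rt (- r w) w) ^+ n))).
  have /continuousCP cD := differentiable_continuous (D_diff x).
  have Dx0 : 0 < nc (D x) by rewrite nc_gt0.
  have [e e0 He] := cD _ Dx0.
  exists e => // w /He hw.
  have r2 : r w ^+ 2 = D w.
    rewrite /r exprMn csq_sqr.
      have -> : s0 ^+ 2 = D x by exact: sqr_sqrtc.
      by field.
    have -> : (1 - D w / D x) / 4 = rc (1 / 4) * ((D x - D w) / D x).
      have -> : rc (1 / 4) = 1 / 4 :> CC R.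
        by rewrite /rc /= fmorph_div rmorph1 rmorph_nat.
      by field.
    rewrite reM re_rc im_rc mul0r subr0 ler_piMr //.
    apply: le_trans (ler_norm _) _; apply: le_trans (re_le _) _.
    by rewrite ncM ncV ler_pdivrMr // mul1r ncC ltW.
  have : (r w == sqrtc (D w)) || (r w == - sqrtc (D w)).
    rewrite -eqf_sqr r2; apply/eqP; symmetry; exact: sqr_sqrtc.
  rewrite /G; case/orP => /eqP -> //.
  by rewrite opprK [X in _ * X]addrC.
apply: differentiableM; first exact: D_diff.
apply: differentiableD; first exact: rt_diff.
by apply: (@rt_diff (fun w => - r w)); exact: differentiableN.
Qed.

End quadratic_curve.

Lemma small_pow (kap x : CC R) d : nc kap <= 4 -> (0 < d)%N -> nc x <= 1 / 2 ->
  nc (kap * x ^+ d) <= 2.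
Proof.
case: d => // d k4 _ xh.
have p1 : nc x ^+ d <= 1 by apply: exprn_ile1; [exact: nc_ge0|lra].
have p0 : 0 <= nc x ^+ d by rewrite exprn_ge0 ?nc_ge0.
rewrite ncM ncX exprS; apply: (@le_trans _ _ (4 * (1 / 2 * 1))); last lra.
by rewrite ler_pM ?nc_ge0 // ?mulr_ge0 ?nc_ge0 // ler_pM ?nc_ge0.
Qed.

(** Through each point of the target polydisc passes a curve y (y - kap x^d) =
    c with |c| <= 3 Y^2.  Over |x| = s the product of its two roots is small
    compared with their sum kap x^d, so one root lies in the disc of radius s
    and the other differs from kap x^d by an element of this disc.  The
    hypotheses bound [h] by b on this boundary, and the maximum principle
    applies to the symmetrized powers of [h]. *)
Lemma tube_hull (kap : CC R) (d : nat) (s Y : R) : 1 <= nc kap -> nc kap <= 4 ->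
  (0 < d)%N -> 2 <= s -> 1 <= Y -> 6 * Y ^+ 2 <= s ^+ d ->
  (forall x y, nc x <= s -> nc y <= s -> nc (h (x, y)) <= b) ->
  (forall x y, nc x <= s -> nc y <= s -> nc (h (x, y + kap * x ^+ d)) <= b) ->
  forall x y, nc x <= 1 / 2 -> nc y <= Y -> nc (h (x, y)) <= b.
Proof.
move=> k1 k4 d0 s2 Y1 Ys H1 H2 x1 y1 x1h y1Y.
have [c cE] : exists c, c = y1 * (y1 - kap * x1 ^+ d) by eexists.
pose D x := kap ^+ 2 * x ^+ (2 * d) + 4 * c.
pose rt (t : CC R) x := (kap * x ^+ d + t) / 2.
have n4 := nc_nat R 4; have n2 := nc_nat R 2.
have xd := small_pow k4 d0 x1h.
have cY : nc c <= 3 * Y ^+ 2.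
  rewrite cE ncM; have := ncB y1 (kap * x1 ^+ d); have := nc_ge0 y1.
  have := nc_ge0 (y1 - kap * x1 ^+ d); nra.
have E : D x1 = (2 * y1 - kap * x1 ^+ d) ^+ 2.
  by rewrite /D cE mulnC exprM; ring.
have sqD x : (sqrtc (D x) : CC R) ^+ 2 = D x by exact: sqr_sqrtc.
have [D0|D0] := eqVneq (D x1) 0.
  apply: H1; first lra.
  have : y1 = kap * x1 ^+ d / 2.
    have : 2 * y1 - kap * x1 ^+ d = 0 by apply/eqP; rewrite -sqrf_eq0 -E D0.
    by move/eqP; rewrite subr_eq0 => /eqP <-; field.
  move=> ->; rewrite ncM ncV n2; lra.
pose M := nc kap ^+ 2 * s ^+ (2 * d) + 4 * nc c.
have M0 : 0 <= M.
  by rewrite addr_ge0 // mulr_ge0 ?exprn_ge0 ?nc_ge0 //; lra.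
(* on the boundary circle one of the two roots lies in the polydisc, and the
   other is a point of the tube *)
have bdy x (t : CC R) : t ^+ 2 = D x -> nc x = s ->
    nc (h (x, rt t x)) <= b /\ nc (h (x, rt (- t) x)) <= b.
  move=> tD xs; set u := rt t x; set v := rt (- t) x.
  have uv : u + v = kap * x ^+ d by rewrite /u /v /rt; field.
  have uvc : u * v = - c.
    have -> : u * v = ((kap * x ^+ d) ^+ 2 - t ^+ 2) / 4 by rewrite /u /v /rt; field.
    by rewrite tD /D exprMn -exprM mulnC; field.
  have key w z : w + z = kap * x ^+ d -> nc w <= s ->
      nc (h (x, w)) <= b /\ nc (h (x, z)) <= b.
    move=> wz ws; split; first by apply: H1 => //; rewrite xs.
    have -> : z = - w + kap * x ^+ d by rewrite -wz addKr.
    by apply: H2; rewrite ?xs ?ncN.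
  have [us|us] := lerP (nc u) s; first exact: key.
  have [vs|vs] := lerP (nc v) s.
    by have [] := key v u _ vs; first by rewrite addrC.
  exfalso; have h1 := ncD u v; rewrite uv ncM ncX xs in h1.
  have h2 : nc u * nc v = nc c by rewrite -ncM uvc ncN.
  have h3 : s ^+ d <= nc kap * s ^+ d by rewrite ler_peMl // exprn_ge0 //; lra.
  nra.
pose G n x := D x * (h (x, rt (sqrtc (D x)) x) ^+ n + h (x, rt (- sqrtc (D x)) x) ^+ n).
have GM n x : nc x <= s -> nc (G n x) <= M * (2 * b ^+ n).
  apply: (@disc_max R s (M * (2 * b ^+ n)) (G n)).
  - by rewrite !mulr_ge0 // exprn_ge0.
  - by move=> z _; exact: G_diff.
  - move=> z zs; rewrite /G ncM; have [h1 h2] := bdy z _ (sqD z) zs.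
    apply: ler_pM; rewrite ?nc_ge0 //.
      by apply: le_trans (ncD _ _) _; rewrite !ncM !ncX zs n4.
    apply: le_trans (ncD _ _) _; rewrite !ncX.
    have : nc (h (z, rt (sqrtc (D z)) z)) ^+ n <= b ^+ n.
      by rewrite lerXn2r ?nnegrE ?nc_ge0.
    have : nc (h (z, rt (- sqrtc (D z)) z)) ^+ n <= b ^+ n.
      by rewrite lerXn2r ?nnegrE ?nc_ge0.
    lra.
have nD : 0 < nc (D x1) by rewrite nc_gt0.
have PB (u v : CC R) : (forall n, nc (D x1 * (u ^+ n + v ^+ n)) <= M * (2 * b ^+ n)) ->
    nc u <= b.
  move=> HG; apply: (@powersum_bound R u v (M * 2 / nc (D x1))) => // n.
  rewrite mulrAC ler_pdivlMr // mulrC -ncM -mulrA; exact: HG.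
have : (2 * y1 - kap * x1 ^+ d == sqrtc (D x1)) || (2 * y1 - kap * x1 ^+ d == - sqrtc (D x1)).
  by rewrite -eqf_sqr -E; apply/eqP; symmetry; exact: sqr_sqrtc.
case/orP => /eqP Ey.
  have -> : y1 = rt (sqrtc (D x1)) x1 by rewrite /rt -Ey; field.
  by apply: PB => n; apply: GM; lra.
have -> : y1 = rt (- sqrtc (D x1)) x1 by rewrite /rt -Ey; field.
by apply: PB => n; rewrite addrC; apply: GM; lra.
Qed.

End fiber_hull.

(** * A loop around the branch point *)

(** A Moebius transformation from the unit disc onto the disc of radius 4/3,
    sending 0 to 1 and -24/25 to -1.  It is the value of the continued square
    root along the loop parametrized by [loop_base]. *)
Definition loop_root (R : realType) (t : CC R) : CC R := (16 * t + 12) / (12 + 9 * t).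
(** The point z of the base with 1 - 4 z = [loop_root] ^+ 2.  The unit disc is
    mapped into the half plane Re z > -1/4 and wraps around the branch point
    1/4; both 0 and -24/25 are sent to 0. *)
Definition loop_base (R : realType) (t : CC R) : CC R := (1 - loop_root t ^+ 2) / 4.

Section loop_geometry.
Variable R : realType.
Implicit Types t z : CC R.

Lemma den_ge t : nc t <= 1 -> 3 <= nc (12 + 9 * t).
Proof.
move=> t1; have := ncBD (12 : CC R) (12 + 9 * t).
have -> : 12 - (12 + 9 * t) = - (9 * t) by ring.
rewrite ncN ncM !nc_nat; lra.
Qed.

Lemma den_neq0 t : nc t <= 1 -> 12 + 9 * t != 0.
Proof. by move/den_ge => h; rewrite -nc_gt0; lra. Qed.

Lemma loop_root_le t : nc t <= 1 -> nc (loop_root t) <= 4 / 3.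
Proof.
move=> t1; have h := den_ge t1.
rewrite /loop_root ncM ncV ler_pdivrMr; last lra.
rewrite -(ler_pXn2r (n := 2)) ?nnegrE ?mulr_ge0 ?nc_ge0 ?divr_ge0 //.
rewrite exprMn 2!nc_sqr.
have r1 : re (16 * t + 12) = 16 * re t + 12.
  by rewrite [LHS]reD re_natM re_nat.
have r2 : re (12 + 9 * t) = 12 + 9 * re t.
  by rewrite [LHS]reD re_natM re_nat.
have i1 : im (16 * t + 12) = 16 * im t by rewrite [LHS]imD im_natM im_nat addr0.
have i2 : im (12 + 9 * t) = 9 * im t by rewrite [LHS]imD im_natM im_nat add0r.
rewrite r1 r2 i1 i2.
have : re t ^+ 2 + im t ^+ 2 <= 1 by rewrite -nc_sqr expr_le1 // nc_ge0.
set x := re t; set y := im t => H.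
have -> : (4 / 3 : R) ^+ 2 = 16 / 9 by field.
have E1 : (16 * x + 12) ^+ 2 + (16 * y) ^+ 2 =
   256 * (x ^+ 2 + y ^+ 2) + 384 * x + 144 by ring.
have E2 : (12 + 9 * x) ^+ 2 + (9 * y) ^+ 2 =
   81 * (x ^+ 2 + y ^+ 2) + 216 * x + 144 by ring.
rewrite E1 E2; lra.
Qed.

Lemma loop_base_in t : nc t <= 1 -> nc (loop_base t) < 1 /\ -1 / 4 < re (loop_base t).
Proof.
move=> /loop_root_le h; have m2 : nc (loop_root t ^+ 2) <= 16 / 9.
  rewrite ncX; have -> : (16 / 9 : R) = (4 / 3) ^+ 2 by field.
  by rewrite ler_pXn2r ?nnegrE ?nc_ge0 ?divr_ge0.
split.
  rewrite /loop_base ncM ncV nc_nat.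
  have := ncB 1 (loop_root t ^+ 2); rewrite nc1; lra.
have -> : loop_base t = rc (1 / 4) * (1 - loop_root t ^+ 2).
  rewrite /loop_base mulrC; congr (_ * _).
  by rewrite /rc /= fmorph_div rmorph1 rmorph_nat mul1r.
rewrite reM re_rc im_rc mul0r subr0 reB re1.
have := le_trans (ler_norm _) (re_le (loop_root t ^+ 2)); lra.
Qed.

Lemma loop_diff t : nc t <= 1 -> differentiable (@loop_root R) t /\
  differentiable (@loop_base R) t.
Proof.
move=> t1; have dr : differentiable (@loop_root R) t.
  have dl (p : CC R) : differentiable (fun w : CC R => p * w) t.
    by apply: differentiableM; [exact: differentiable_cst|exact: dif_id].
  have dc (p : CC R) : differentiable (fun _ : CC R => p) t.
    exact: differentiable_cst.
  have d1 := differentiableD (dl 16) (dc 12).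
  have d2 := differentiableD (dc 12) (dl 9).
  exact: (differentiableM d1 (differentiableV d2 (den_neq0 t1))).
split; first exact: dr.
have dc (p : CC R) : differentiable (fun _ : CC R => p) t.
  exact: differentiable_cst.
exact: (differentiableM (differentiableB (dc 1) (dif_X 2 dr)) (dc 4^-1)).
Qed.

Lemma csq_unique z w : re z < 1 / 4 -> 0 < re w -> w ^+ 2 = 1 - 4 * z -> csq z = w.
Proof.
move=> hz hw E; have := csq_sqr (ltW hz); rewrite -E => /eqP; rewrite eqf_sqr.
case/orP => /eqP // E'; exfalso; have := re_csq_gt0 hz; rewrite E' reN; lra.
Qed.

(** Near t = 0 the continued square root is the principal one. *)
Lemma loop_start t : nc t = 1 / 100 -> nc (loop_base t) <= 1 / 200 /\
  csq (loop_base t) = loop_root t.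
Proof.
move=> t1; have t1' : nc t <= 1 by lra.
have dn := den_neq0 t1'.
have d11 : 11 <= nc (12 + 9 * t).
  have := ncBD (12 : CC R) (12 + 9 * t).
  have -> : 12 - (12 + 9 * t) = - (9 * t) by ring.
  rewrite ncN ncM !nc_nat; lra.
have m1 : nc (loop_root t - 1) <= 1 / 150.
  have -> : loop_root t - 1 = 7 * t / (12 + 9 * t) by rewrite /loop_root; field.
  rewrite ncM ncV ler_pdivrMr; last lra.
  rewrite ncM nc_nat t1; lra.
have m2 : nc (loop_root t + 1) <= 3.
  have -> : loop_root t + 1 = (loop_root t - 1) + 2 by ring.
  apply: le_trans (ncD _ _) _; rewrite nc_nat; lra.
have b : nc (loop_base t) <= 1 / 200.
  have -> : loop_base t = - ((loop_root t - 1) * (loop_root t + 1)) / 4.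
    by rewrite /loop_base; field.
  rewrite ncM ncV ncN ncM nc_nat.
  have := ler_pM (nc_ge0 _) (nc_ge0 _) m1 m2; lra.
split => //; apply: csq_unique.
- have := le_trans (ler_norm _) (re_le (loop_base t)); lra.
- have := re_le (loop_root t - 1); rewrite ler_norml reB re1 => /andP[h _]; lra.
- by rewrite /loop_base; field.
Qed.

Lemma csq_near1 z : nc z <= 1 / 200 -> nc (csq z - 1) <= 1 / 50.
Proof.
move=> hz; have rz : re z < 1 / 4.
  have := le_trans (ler_norm _) (re_le z); lra.
have h := re_csq_gt0 rz.
have n1 : 1 <= nc (csq z + 1).
  apply: le_trans (le_trans (ler_norm _) (re_le _)); rewrite reD re1; lra.
have E : (csq z - 1) * (csq z + 1) = - (4 * z).
  by rewrite -subr_sqr_1 (csq_sqr (ltW rz)); ring.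
have : nc (csq z - 1) * nc (csq z + 1) <= 4 * (1 / 200).
  by rewrite -ncM E ncN ncM nc_nat ler_pM2l.
have := nc_ge0 (csq z - 1); nra.
Qed.

(** The equation [loop_root] t = - [csq] z has an explicit solution, close to
    -24/25, for every z near 0. *)
Lemma loop_end z : nc z <= 1 / 200 -> exists t, [/\ 1 / 100 <= nc t, nc t <= 49 / 50,
  loop_base t = z & loop_root t = - csq z].
Proof.
move=> hz; have rz : re z < 1 / 4.
  have := le_trans (ler_norm _) (re_le z); lra.
have ha := csq_near1 hz; set a := csq z in ha *.
have n16 : 2482 / 100 <= nc (16 + 9 * a).
  have := ncBD (25 : CC R) (16 + 9 * a).
  have -> : 25 - (16 + 9 * a) = - (9 * (a - 1)) by ring.
  rewrite ncN ncM !nc_nat; lra.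
have n16' : nc (16 + 9 * a) <= 26.
  have -> : 16 + 9 * a = 25 + 9 * (a - 1) by ring.
  apply: le_trans (ncD _ _) _; rewrite ncM !nc_nat; lra.
have n2 : nc (1 + a) <= 2 + 1 / 50.
  have -> : 1 + a = 2 + (a - 1) by ring.
  apply: le_trans (ncD _ _) _; rewrite nc_nat; lra.
have n2' : 1 <= nc (1 + a).
  have := ncBD (2 : CC R) (1 + a); have -> : 2 - (1 + a) = - (a - 1) by ring.
  rewrite ncN nc_nat; lra.
have nz : 16 + 9 * a != 0 by rewrite -nc_gt0; lra.
have rt : loop_root (- (12 * (1 + a) / (16 + 9 * a))) = - a.
  rewrite /loop_root; have e1 : 12 + 9 * - (12 * (1 + a) / (16 + 9 * a)) = 84 / (16 + 9 * a) by field.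
  have e2 : 16 * - (12 * (1 + a) / (16 + 9 * a)) + 12 = - (84 * a) / (16 + 9 * a) by field.
  by rewrite e1 e2; field; rewrite nz ?pnatr_eq0.
have E : nc (- (12 * (1 + a) / (16 + 9 * a))) = 12 * nc (1 + a) / nc (16 + 9 * a).
  by rewrite ncN ncM ncV ncM nc_nat.
exists (- (12 * (1 + a) / (16 + 9 * a))); split => //.
- rewrite E ler_pdivlMr; lra.
- rewrite E ler_pdivrMr; lra.
- by rewrite /loop_base rt sqrrN /a (csq_sqr (ltW rz)); field.
Qed.

End loop_geometry.

(** * Growth along a fibre *)

Section bounded_on.
Variable R : realType.

Lemma bounded_on (f : CC R * (CC R * CC R) -> CC R) (K1 K2 K3 : set (CC R)) :
  compact K1 -> compact K2 -> compact K3 ->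
  (forall x y z, K1 x -> K2 y -> K3 z -> differentiable f (x, (y, z))) ->
  exists2 b : R, 0 <= b &
    forall x y z, K1 x -> K2 y -> K3 z -> nc (f (x, (y, z))) <= b.
Proof.
move=> c1 c2 c3 df.
have cK : compact (K1 `*` (K2 `*` K3)) by apply: compact_setX => //; exact: compact_setX.
have [[p Kp]|K0] := pselect ((K1 `*` (K2 `*` K3)) !=set0); last first.
  by exists 0 => // x y z h1 h2 h3; case: K0; exists (x, (y, z)).
have cf : {within K1 `*` (K2 `*` K3), continuous (fun p => nc (f p))}.
  apply: continuous_in_subspaceT => -[x [y z]]; rewrite inE => -[/= h1 [h2 h3]].
  have cd := differentiable_continuous (df _ _ _ h1 h2 h3).
  by apply: (continuous_comp cd); exact: nc_continuous.
have [q _ Hq] := compact_EVT_max (ex_intro _ p Kp) cK cf.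
exists (nc (f q)); first exact: nc_ge0.
by move=> x y z h1 h2 h3; apply: (Hq (x, (y, z))); rewrite inE.
Qed.

End bounded_on.

(** The hypothesis on [d] says that s^d is at least 6 r^8, where s = (50/49)^N
    and r = 100^N.  The condition 50 <= N gives 2 <= s. *)
Section tube_step.
Variables (R : realType) (d : nat).
Implicit Types (f : CC R * (CC R * CC R) -> CC R) (z x y : CC R).

(** The function in flat coordinates, when [f] is given in the coordinates (z,
    x, y - csq z x^d) that are holomorphic over the right half of the base. *)
Definition flat f z x y : CC R := f (z, (x, y - csq z * x ^+ d)).

Definition holo_right f := forall z x y, nc z < 1 -> -1 / 4 < re z ->
  differentiable f (z, (x, y)).

Lemma small_base z : nc z <= 1 / 200 -> [/\ nc z < 1, -1 / 4 < re z & re z < 1 / 4].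
Proof.
move=> h; have := re_le z; rewrite ler_norml => /andP[h1 h2]; split; lra.
Qed.

(** A bound over the whole loop, for points of the fibres that are in the unit
    polydisc with respect to the continued flat coordinates. *)
Definition loop_bound f b := forall t x y, nc t <= 1 -> nc x <= 1 -> nc y <= 1 ->
  nc (f (loop_base t, (x, y - loop_root t * x ^+ d))) <= b.

(** The disc |z| <= 1/200 contains the image of |t| = 1/100 under [loop_base],
    and it is contained in the image of |t| <= 49/50: a loop that starts on it
    can be followed until it returns over any of its points. *)
Definition core_bound f N b := forall z x y, nc z <= 1 / 200 ->
  nc x <= 100 ^+ N -> nc y <= 100 ^+ N -> nc (flat f z x y) <= b.

Lemma dif3 f (V : normedModType (CC R)) (g1 g2 g3 : V -> CC R) v :
  differentiable g1 v -> differentiable g2 v -> differentiable g3 v ->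
  differentiable f (g1 v, (g2 v, g3 v)) ->
  differentiable (fun w => f (g1 w, (g2 w, g3 w))) v.
Proof.
move=> d1 d2 d3 df.
have d23 := differentiable_pair d2 d3.
have d123 := differentiable_pair d1 d23.
exact: (@differentiable_comp _ _ _ _ (fun w => (g1 w, (g2 w, g3 w))) f).
Qed.

Lemma dif_shear (V : normedModType (CC R)) (g1 g2 g3 : V -> CC R) n v :
  differentiable g1 v -> differentiable g2 v -> differentiable g3 v ->
  differentiable (fun w => g3 w - g1 w * g2 w ^+ n) v.
Proof.
move=> d1 d2 d3.
exact: (differentiableB d3 (differentiableM d1 (dif_X n d2))).
Qed.

(** For a fixed end point (x, y), the disc t |-> (loop_base t, x0 / t^N, y0 /
    t^N), written in flat coordinates continued along the loop, has its outer
    boundary in the set controlled by [loop_bound].  On |t| = 1/100 it is still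
    on the principal branch, in the polydisc of radius 100^N.  It passes
    through (x, y) at a point t with |t| <= 49/50, where the square root has
    changed sign. *)
Lemma loop_continuation f N b : 0 <= b -> holo_right f -> loop_bound f b ->
  core_bound f N b ->
  forall z x y, nc z <= 1 / 200 -> nc x <= (50 / 49) ^+ N -> nc y <= (50 / 49) ^+ N ->
    nc (f (z, (x, y + csq z * x ^+ d))) <= b.
Proof.
move=> b0 hf Hl Hc z x y hz hx hy.
have [t0 [t1 t2 Ez Er]] := loop_end hz.
have t0n : t0 != 0 by rewrite -nc_gt0; lra.
pose x0 := x * t0 ^+ N; pose y0 := y * t0 ^+ N.
have sc (w : CC R) : nc w <= (50 / 49) ^+ N -> nc (w * t0 ^+ N) <= 1.
  move=> hw; rewrite ncM ncX.
  apply: (@le_trans _ _ ((50 / 49) ^+ N * (49 / 50) ^+ N)).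
    apply: ler_pM; rewrite ?exprn_ge0 ?nc_ge0 //.
    by apply: lerXn2r; rewrite ?nnegrE ?nc_ge0 // divr_ge0.
  rewrite -exprMn; have -> : (50 / 49 * (49 / 50) : R) = 1 by field.
  by rewrite expr1n.
pose f' t := f (loop_base t, (x0 / t ^+ N, y0 / t ^+ N - loop_root t * (x0 / t ^+ N) ^+ d)).
have -> : f (z, (x, y + csq z * x ^+ d)) = f' t0.
  rewrite /f' /x0 /y0 Ez Er !mulfK ?expf_neq0 //.
  by rewrite mulNr opprK.
apply: (@annulus_max R (1 / 100) 1 b f' b0).
- move=> t /andP[h1 h2]; have tn : t != 0 by rewrite -nc_gt0; lra.
  have [dr db] := loop_diff h2; have [i1 i2] := loop_base_in h2.
  have dt (p : CC R) : differentiable (fun w : CC R => p / w ^+ N) t.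
    apply: differentiableM; first exact: differentiable_cst.
    apply: differentiableV; last exact: expf_neq0.
    by apply: dif_X; exact: dif_id.
  exact: (dif3 db (dt x0) (dif_shear d dr (dt x0) (dt y0)) (hf _ _ _ i1 i2)).
- move=> t h; have h' : nc t <= 1 by lra.
  have [i1 i2] := loop_start h; rewrite /f' -i2.
  have sc' (w : CC R) : nc w <= 1 -> nc (w / t ^+ N) <= 100 ^+ N.
    move=> hw; rewrite ncM ncV ncX h.
    have -> : ((1 / 100 : R) ^+ N)^-1 = 100 ^+ N by rewrite -exprVn invf_div divr1.
    by rewrite ler_piMl // exprn_ge0.
  by apply: Hc => //; apply: sc'; exact: sc.
- move=> t h; apply: Hl; first lra.
    by rewrite ncM ncV ncX h expr1n divr1 sc.
  by rewrite ncM ncV ncX h expr1n divr1 sc.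
- by apply/andP; split => //; lra.
Qed.

Lemma flat_diff f z p : holo_right f -> nc z <= 1 / 200 ->
  differentiable (fun q : CC R * CC R => flat f z q.1 q.2) p.
Proof.
move=> hf hz; have [z1 z2 z3] := small_base hz.
have dz : differentiable (fun _ : CC R * CC R => z) p by exact: differentiable_cst.
have da : differentiable (fun _ : CC R * CC R => csq z) p by exact: differentiable_cst.
have ds := dif_shear d da (dif_fst p) (dif_snd p).
by apply: (dif3 dz (dif_fst p) ds); exact: hf.
Qed.

Lemma tube_step f N b : 0 <= b -> (0 < d)%N -> (50 <= N)%N ->
  6 * 100 ^+ 8 <= (50 / 49 : R) ^+ d ->
  holo_right f -> loop_bound f b -> core_bound f N b ->
  forall z x y, nc z <= 1 / 200 -> nc x <= 1 / 2 -> nc y <= 100 ^+ (4 * N) ->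
    nc (flat f z x y) <= b.
Proof.
move=> b0 d0 N50 dlarge hf Hl Hc z x y hz.
have [z1 z2 z3] := small_base hz.
have ha := csq_near1 hz; set a := csq z in ha *.
have na1 : nc a <= 1 + 1 / 50.
  by have := ncBD a 1; rewrite nc1; lra.
have na2 : 1 - 1 / 50 <= nc a.
  by have := ncBD 1 a; rewrite nc1 ncC; lra.
have s2 : 2 <= (50 / 49 : R) ^+ N.
  have h50 : 2 <= (50 / 49 : R) ^+ 50.
    have -> : (50 / 49 : R) = 1 + 1 / 49 by field.
    apply: le_trans (@bernoulli R _ 50 _); last lra.
    rewrite -mulr_natr; lra.
  apply: le_trans h50 _; apply: ler_weXn2l => //; lra.
have sN : (50 / 49 : R) ^+ N <= 100 ^+ N.
  by apply: lerXn2r; rewrite ?nnegrE ?divr_ge0 //; lra.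
apply: (@tube_hull R (fun q => flat f z q.1 q.2) b _ b0 (2 * a) d ((50 / 49) ^+ N)
    (100 ^+ (4 * N))) => //.
- by move=> p; exact: flat_diff.
- rewrite ncM nc_nat; lra.
- rewrite ncM nc_nat; lra.
- by rewrite exprn_ege1 // ler1n.
- have -> : ((50 / 49 : R) ^+ N) ^+ d = ((50 / 49) ^+ d) ^+ N.
    by rewrite -[LHS]exprM mulnC [LHS]exprM.
  have -> : ((100 : R) ^+ (4 * N)) ^+ 2 = (100 ^+ 8) ^+ N.
    by rewrite -[LHS]exprM -[RHS]exprM mulnAC.
  apply: (@le_trans _ _ ((6 * 100 ^+ 8) ^+ N)); last first.
    by apply: lerXn2r; rewrite ?nnegrE ?mulr_ge0 ?exprn_ge0 ?divr_ge0.
  rewrite [leRHS]exprMn; apply: ler_wpM2r; first by rewrite !exprn_ge0.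
  by apply: ler_eXnr; rewrite ?ler1n // (leq_trans _ N50).
- move=> x' y' h1 h2; apply: Hc => //; exact: le_trans sN.
- move=> x' y' h1 h2 /=; rewrite /flat -/a.
  have -> : y' + 2 * a * x' ^+ d - a * x' ^+ d = y' + a * x' ^+ d by ring.
  exact: (loop_continuation b0 hf Hl Hc).
Qed.

End tube_step.

Section nonseparation.
Variables (R : realType) (d : nat) (fP fQ : CC R * (CC R * CC R) -> CC R).
Hypotheses (d0 : (0 < d)%N) (dlarge : 6 * 100 ^+ 8 <= (50 / 49 : R) ^+ d).
Hypothesis hP : forall z x y : CC R, nc z < 1 -> -1 / 4 < re z ->
  differentiable fP (z, (x, y)).
Hypothesis hQ : forall z x y : CC R, nc z < 1 -> re z < 1 / 4 ->
  differentiable fQ (z, (x, y)).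
Hypothesis hPQ : forall z x y : CC R, nc z < 1 -> -1 / 4 < re z -> re z < 1 / 4 ->
  fP (z, (x, y - csq z * x ^+ d)) = fQ (z, (x - csq (- z) * y ^+ d, y)).

(** The involution (z, x, y) |-> (-z, y, x) exchanges the two halves of the
    base, so that every statement about [fP] also holds for [fQ]. *)
Definition mirror p : CC R := fQ (- p.1, (p.2.2, p.2.1)).

Lemma mirror_right : holo_right mirror.
Proof.
move=> z x y hz rz.
have h1 := dif_fst (z, (x, y)); have h2 := dif_snd (z, (x, y)).
have h21 : differentiable (fun p : CC R * (CC R * CC R) => p.2.1) (z, (x, y)).
  by apply: (@differentiable_comp _ _ _ _ snd fst) => //; exact: dif_fst.
have h22 : differentiable (fun p : CC R * (CC R * CC R) => p.2.2) (z, (x, y)).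
  by apply: (@differentiable_comp _ _ _ _ snd snd) => //; exact: dif_snd.
apply: (dif3 (differentiableN h1) h22 h21).
by apply: hQ; rewrite ?ncN ?reN /=; lra.
Qed.

Lemma flat_mirror z x y : nc z <= 1 / 200 ->
  flat d mirror z x y = flat d fP (- z) y x.
Proof.
move=> hz; have [z1 z2 z3] := small_base hz.
rewrite /flat /mirror /= hPQ ?opprK ?ncN ?reN //; lra.
Qed.

Lemma loop_bound_exists f : holo_right f -> exists2 b : R, 0 <= b & loop_bound d f b.
Proof.
move=> hf.
pose g p : CC R := f (loop_base p.1, (p.2.1, p.2.2 - loop_root p.1 * p.2.1 ^+ d)).
have cd := @compact_disc R 1.
have [|b b0 Hb] := @bounded_on R g _ _ _ cd cd cd; last first.
  by exists b => // t x y h1 h2 h3; exact: (Hb t x y).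
move=> t x y ht _ _; rewrite /= in ht.
have [dr db] := loop_diff ht; have [i1 i2] := loop_base_in ht.
have h1 := dif_fst (t, (x, y)); have h2 := dif_snd (t, (x, y)).
have h21 : differentiable (fun p : CC R * (CC R * CC R) => p.2.1) (t, (x, y)).
  by apply: (@differentiable_comp _ _ _ _ snd fst) => //; exact: dif_fst.
have h22 : differentiable (fun p : CC R * (CC R * CC R) => p.2.2) (t, (x, y)).
  by apply: (@differentiable_comp _ _ _ _ snd snd) => //; exact: dif_snd.
have hr := differentiable_comp h1 (dr : differentiable (@loop_root R) (fst (t, (x, y)))).
have hb := differentiable_comp h1 (db : differentiable (@loop_base R) (fst (t, (x, y)))).
exact: (dif3 hb h21 (dif_shear d hr h21 h22) (hf _ _ _ i1 i2)).
Qed.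

Lemma core_bound_exists N : exists2 b : R, 0 <= b & core_bound d fP N b.
Proof.
pose g p : CC R := fP (p.1, (p.2.1, p.2.2 - csq p.1 * p.2.1 ^+ d)).
have cd := @compact_disc R (100 ^+ N).
have [|b b0 Hb] := @bounded_on R g _ _ _ (@compact_disc R (1 / 200)) cd cd; last first.
  by exists b => // t x y h1 h2 h3; exact: (Hb t x y).
move=> t x y ht _ _; rewrite /= in ht; have [z1 z2 z3] := small_base ht.
have h1 := dif_fst (t, (x, y)); have h2 := dif_snd (t, (x, y)).
have h21 : differentiable (fun p : CC R * (CC R * CC R) => p.2.1) (t, (x, y)).
  by apply: (@differentiable_comp _ _ _ _ snd fst) => //; exact: dif_fst.
have h22 : differentiable (fun p : CC R * (CC R * CC R) => p.2.2) (t, (x, y)).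
  by apply: (@differentiable_comp _ _ _ _ snd snd) => //; exact: dif_snd.
have hr := differentiable_comp h1 (csq_diff z3 : differentiable (@csq R) (fst (t, (x, y)))).
exact: (dif3 h1 h21 (dif_shear d hr h21 h22) (hP _ _ z1 z2)).
Qed.

(** The two tubes, one for each branch point, give polydiscs that are long in
    the y-direction and in the x-direction; hyperbolas fill the polydisc
    between them. *)
Lemma core_step N b : 0 <= b -> (50 <= N)%N -> loop_bound d fP b ->
  loop_bound d mirror b -> core_bound d fP N b -> core_bound d fP N.+1 b.
Proof.
move=> b0 N50 lP lQ cP.
have cQ : core_bound d mirror N b.
  by move=> z x y hz hx hy; rewrite flat_mirror //; apply: cP; rewrite ?ncN.
have tP := tube_step b0 d0 N50 dlarge hP lP cP.
have tQ := tube_step b0 d0 N50 dlarge mirror_right lQ cQ.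
move=> z x y hz.
apply: (@hyper_hull R (fun q => flat d fP z q.1 q.2) b _ b0 (100 ^+ (4 * N)) (100 ^+ N.+1)).
- by move=> p; exact: flat_diff.
- by rewrite exprn_ege1 // ler1n.
- apply: (@le_trans _ _ (100 * (100 ^+ N.+1) ^+ 2)).
    by rewrite ler_wpM2r ?exprn_ge0 // ler_nat.
  rewrite -[(_ ^+ N.+1) ^+ 2]exprM -exprS; apply: ler_weXn2l; first by rewrite ler1n.
  move: N50; clear; lia.
- by move=> x' y' h1 h2; exact: tP.
- move=> x' y' h1 h2; have := tQ (- z) y' x'; rewrite flat_mirror ?ncN // opprK.
  exact.
Qed.

(** The two points are (1, 0) and (0, 0) in the flat coordinates of the fibre
    over 0. *)
Theorem fiber_points_not_separated : fP (0, (1, - csq 0)) = fP (0, (0, 0)).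
Proof.
have [b1 b10 l1] := loop_bound_exists hP.
have [b2 b20 l2] := loop_bound_exists mirror_right.
have [b3 b30 l3] := core_bound_exists 50.
pose b := b1 + b2 + b3; have b0 : 0 <= b by rewrite !addr_ge0.
have lP : loop_bound d fP b.
  by move=> t x y h1 h2 h3; apply: le_trans (l1 _ _ _ h1 h2 h3) _; rewrite /b; lra.
have lQ : loop_bound d mirror b.
  by move=> t x y h1 h2 h3; apply: le_trans (l2 _ _ _ h1 h2 h3) _; rewrite /b; lra.
have core k : core_bound d fP (50 + k) b.
  elim: k => [|k IH].
    by move=> t x y h1 h2 h3; apply: le_trans (l3 _ _ _ h1 h2 h3) _; rewrite /b; lra.
  by rewrite addnS; apply: core_step => //; exact: leq_addr.
have z0 : nc (0 : CC R) <= 1 / 200 by rewrite nc0 divr_ge0.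
have bd x : nc (flat d fP 0 x 0) <= b.
  have [n Hn] : exists n, nc x < (100 : R) ^+ n by apply: expr_unbounded; rewrite ltr1n.
  apply: (core n) => //; last by rewrite nc0 exprn_ge0.
  apply: le_trans (ltW Hn) _; apply: ler_weXn2l; [by rewrite ler1n|exact: leq_addl].
have dk x : differentiable (fun w => flat d fP 0 w 0) x.
  have h := flat_diff d (x, 0) hP z0.
  have hp := differentiable_pair (dif_id x) (differentiable_cst (0 : CC R) x).
  exact: (differentiable_comp hp h).
have := @liouville R b b0 _ dk bd; rewrite /flat expr1n mulr1 sub0r expr0n.
by rewrite gtn_eqF // mulr0 subr0.
Qed.

End nonseparation.

(** * Topology of the total space *)

Lemma differentiable_near (K : numFieldType) (V W : normedModType K) (f g : V -> W) x :
  (\forall y \near x, f y = g y) -> differentiable g x -> differentiable f x.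
Proof.
move=> fg dg; have fgx : f x = g x := nbhs_singleton fg.
have [c1 E1] := (iffLR (diff_locallyP x g)) dg.
have fg0 : \forall y \near 0, f (y + x) = g (y + x).
  have : y + x @[y --> 0] --> 0 + x by apply: cvgD; [exact: cvg_id|exact: cvg_cst].
  by rewrite add0r => /(_ _ fg).
have E : f \o shift x = cst (f x) + 'd g x +o_ 0 id.
  apply/eqaddoP => e e0; have H1 := (iffLR (eqaddoP _ _ _ _)) E1 e e0.
  near=> y; have Hy : `|(g \o shift x - (cst (g x) + 'd g x)) y| <= e * `|id y|.
    by near: y.
  have Ey : f (y + x) = g (y + x) by near: y.
  by move: Hy; rewrite /= fgx !fctE /= Ey.
have du := diff_unique c1 E.
by apply/diff_locallyP; rewrite du; split.
Unshelve. all: by end_near. Qed.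

Section base_space.
Variable R : realType.
Local Notation V3 := (CC R * (CC R * CC R))%type.

Lemma nbhsV3P (v : V3) (A : set V3) : nbhs v A <-> exists2 e : R, 0 < e &
  forall w, nc (w.1 - v.1) < e -> nc (w.2.1 - v.2.1) < e ->
    nc (w.2.2 - v.2.2) < e -> A w.
Proof.
split.
  case=> [[P Q] [/= /nbhsCP[e1 e10 H1] [[Q1 Q2] [/= /nbhsCP[e2 e20 H2] /nbhsCP[e3 e30 H3]] H']] H].
  exists (Num.min e1 (Num.min e2 e3)); first by rewrite !lt_min e10 e20.
  move=> [w1 [w2 w3]] /=; rewrite !lt_min => /and3P[h1 _ _] /and3P[_ h2 _] /and3P[_ _ h3].
  apply: H; split => /=; first exact: H1.
  by apply: H'; split => /=; [exact: H2|exact: H3].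
case=> e e0 H.
exists ([set z | nc (z - v.1) < e], [set q | nc (q.1 - v.2.1) < e /\ nc (q.2 - v.2.2) < e]).
  split => /=; first by apply/nbhsCP; exists e.
  exists ([set z | nc (z - v.2.1) < e], [set z | nc (z - v.2.2) < e]).
    by split => /=; apply/nbhsCP; exists e.
  by move=> [a b] [].
by move=> w [/= h1 [h2 h3]]; exact: H.
Qed.

Variable B : set (CC R).
(** In flat coordinates the total space is an open subset of C x C^2, with the
    induced topology.  Its complex structure is not the induced one. *)
Definition over_base : set V3 := [set v | B v.1].
Definition total_pts := set_type over_base.

Lemma total_pts_base (e : total_pts) : B (val e).1.
Proof. by have := valP e; rewrite inE. Qed.

Lemma nbhs_total_ptsP (e : total_pts) (A : set total_pts) : nbhs e A <->
  exists2 r : R, 0 < r & forall e' : total_pts, nc ((val e').1 - (val e).1) < r ->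
    nc ((val e').2.1 - (val e).2.1) < r -> nc ((val e').2.2 - (val e).2.2) < r -> A e'.
Proof.
split.
  case=> _ /= [[W oW <-] /= We sWA].
  have /nbhsV3P[r r0 Hr] : nbhs (set_val e) W by apply: open_nbhs_nbhs; split.
  by exists r => // e' h1 h2 h3; apply: sWA; apply: Hr.
case=> r r0 H.
have : nbhs (val e : V3) [set w | nc (w.1 - (val e).1) < r /\
   nc (w.2.1 - (val e).2.1) < r /\ nc (w.2.2 - (val e).2.2) < r].
  by apply/nbhsV3P; exists r => // w h1 h2 h3; split.
rewrite nbhsE => -[W [oW We] HW].
exists (set_val @^-1` W); split; [by exists W|exact: We|].
by move=> e' We'; have /= [h1 [h2 h3]] := HW _ We'; exact: H.
Qed.

Lemma val_continuous : continuous (fun e : total_pts => val e : V3).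
Proof. exact: initial_continuous. Qed.

Lemma total_pts_hausdorff : hausdorff_space total_pts.
Proof.
rewrite open_hausdorff => e e' ee'.
have ne : (val e : V3) != val e' by apply: contra ee' => /eqP h; apply/eqP/val_inj.
have := @norm_hausdorff _ V3; rewrite open_hausdorff => /(_ _ _ ne) [] [P Q] /= [h1 h2] [oP oQ h3].
exists (set_val @^-1` P, set_val @^-1` Q) => //=; split => //.
- by exists P.
- by exists Q.
- rewrite -preimage_setI; move: h3 => /= /eqP ->; by rewrite preimage_set0.
Qed.

End base_space.

(** * Shear charts *)

Lemma cont_pair (S T1 T2 : topologicalType) (f : S -> T1) (g : S -> T2) (v : S) :
  {for v, continuous f} -> {for v, continuous g} ->
  {for v, continuous (fun w => (f w, g w))}.
Proof. by move=> cf cg; exact: (cvg_pair cf cg). Qed.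

Section bundle_data.
Variables (R : realType) (B : set (CC R)) (d : nat).
Hypotheses (Bo : open B) (B1 : forall z : CC R, nc z < 1 -> B z).
Local Notation V3 := (CC R * (CC R * CC R))%type.
Local Notation F2 := (CC R * CC R)%type.
Local Notation T := (total_pts B).

Lemma rat_approx (z : CC R) (e : R) : 0 < e ->
  exists q : rat * rat, nc (z - cx (ratr q.1) (ratr q.2)) < e.
Proof.
move=> e0.
have near (x : R) : exists q : rat, `|x - ratr q| < e / 2.
  have [q] := @rat_in_itvoo R (x - e / 2) (x + e / 2) ltac:(lra).
  rewrite in_itv /= => /andP[h1 h2]; exists q.
  by rewrite ltr_norml; apply/andP; split; lra.
have [q1 h1] := near (re z); have [q2 h2] := near (im z).
exists (q1, q2); apply: le_lt_trans (nc_le _) _.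
rewrite reB imB re_cx im_cx /=; lra.
Qed.

(** A countable basis is given by the boxes with rational centres and radii 1 /
    (n + 1). *)
Lemma total_pts_second_countable : @second_countable T.
Proof.
pose ctr (q : rat * rat) : CC R := cx (ratr q.1) (ratr q.2).
pose box (p : (rat * rat) * ((rat * rat) * (rat * rat)) * nat) : set T :=
  [set e | [/\ nc ((val e).1 - ctr p.1.1) < (p.2%:R + 1)^-1,
     nc ((val e).2.1 - ctr p.1.2.1) < (p.2%:R + 1)^-1 &
     nc ((val e).2.2 - ctr p.1.2.2) < (p.2%:R + 1)^-1]].
have box_open p : open (box p).
  rewrite openE => e [h1 h2 h3]; apply/nbhs_total_ptsP.
  set r := (p.2%:R + 1)^-1 in h1 h2 h3.
  exists (Num.min (r - nc ((val e).1 - ctr p.1.1))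
    (Num.min (r - nc ((val e).2.1 - ctr p.1.2.1)) (r - nc ((val e).2.2 - ctr p.1.2.2)))).
    by rewrite !lt_min !subr_gt0 h1 h2 h3.
  have tri (x y c : CC R) : nc (x - y) < r - nc (y - c) -> nc (x - c) < r.
    move=> h; have -> : x - c = (x - y) + (y - c) by ring.
    by apply: le_lt_trans (ncD _ _) _; lra.
  move=> e'; rewrite !lt_min => /and3P[/tri k1 _ _] /and3P[_ /tri k2 _] /and3P[_ _ /tri k3].
  by split.
exists (range box).
  by apply: sub_countable (card_image_le _ _) (countableP _).
split; first by move=> _ [p _ <-].
move=> e A /nbhs_total_ptsP[r r0 HA].
have Hn := archi_boundP (ltW (divr_gt0 (ltr0n R 2) r0)); set n := Num.bound _ in Hn.
have n0 : 0 < n%:R + 1 :> R by rewrite ltr_wpDl.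
have nr : (n%:R + 1)^-1 <= r / 2.
  rewrite -[r / 2]invrK lef_pV2 ?posrE ?invr_gt0 ?divr_gt0 //.
  by rewrite invf_div; apply: ltW; apply: lt_trans Hn _; rewrite ltrDl.
have s0 : 0 < (n%:R + 1)^-1 :> R by rewrite invr_gt0.
have [q1 h1] := rat_approx (val e).1 s0.
have [q2 h2] := rat_approx (val e).2.1 s0.
have [q3 h3] := rat_approx (val e).2.2 s0.
exists (box ((q1, (q2, q3)), n)).
  by split; [exists ((q1, (q2, q3)), n)|split].
have tri (x y c : CC R) : nc (x - c) < (n%:R + 1)^-1 ->
    nc (y - c) < (n%:R + 1)^-1 -> nc (y - x) < r.
  move=> k1 k2; have -> : y - x = (y - c) - (x - c) by ring.
  by apply: le_lt_trans (ncB _ _) _; lra.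
by move=> e' [/= k1 k2 k3]; apply: HA; [exact: tri k1|exact: tri k2|exact: tri k3].
Qed.

Lemma total0 : over_base B (0, (0, 0)).
Proof. by apply: B1; rewrite nc0. Qed.
Definition origin_pt : T := exist _ (0, (0, 0)) (mem_set total0).
(** Triples outside the total space are sent to its origin, which makes the
    inverse of a chart a total function. *)
Definition to_total (v : V3) : T := insubd origin_pt v.

Lemma to_totalK v : B v.1 -> val (to_total v) = v.
Proof. by move=> Bv; rewrite val_insubd; case: ifP => // /negP; case; exact/mem_set. Qed.

Lemma to_total_val (e : T) : to_total (val e) = e.
Proof. exact: valKd. Qed.

(** The right half of the base for [true], the left half for [false]. *)
Definition half_base (b : bool) : set (CC R) :=
  [set z | B z /\ if b then -1 / 4 < re z else re z < 1 / 4].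

(** From the flat coordinates of a fibre to those of the chart over [half_base
    b]. *)
Definition shear (b : bool) (z : CC R) (w : F2) : F2 :=
  if b then (w.1, w.2 - csq z * w.1 ^+ d) else (w.1 - csq (- z) * w.2 ^+ d, w.2).
Definition unshear (b : bool) (z : CC R) (w : F2) : F2 :=
  if b then (w.1, w.2 + csq z * w.1 ^+ d) else (w.1 + csq (- z) * w.2 ^+ d, w.2).

Lemma shearK b z : cancel (shear b z) (unshear b z).
Proof. by case: b => -[x y]; rewrite /shear /unshear /= subrK. Qed.
Lemma unshearK b z : cancel (unshear b z) (shear b z).
Proof. by case: b => -[x y]; rewrite /shear /unshear /= addrK. Qed.

Definition to_flat_chart b (v : V3) : V3 := (v.1, shear b v.1 v.2).
Definition of_flat_chart b (v : V3) : V3 := (v.1, unshear b v.1 v.2).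

Lemma dif21 (v : V3) : differentiable (fun p : V3 => p.2.1) v.
Proof. by apply: (@differentiable_comp _ _ _ _ snd fst); exact: dif_fst || exact: dif_snd. Qed.
Lemma dif22 (v : V3) : differentiable (fun p : V3 => p.2.2) v.
Proof. by apply: (@differentiable_comp _ _ _ _ snd snd); exact: dif_snd. Qed.

Lemma cont_shear (g1 g2 g3 : V3 -> CC R) (v : V3) :
  {for v, continuous g1} -> {for v, continuous g2} -> {for v, continuous g3} ->
  {for v, continuous (fun w => g3 w + g1 w * g2 w ^+ d)} /\
  {for v, continuous (fun w => g3 w - g1 w * g2 w ^+ d)}.
Proof.
move=> c1 c2 c3.
have dX : differentiable (fun u : CC R => u ^+ d) (g2 v).
  by apply: dif_X; exact: dif_id.
have c2d := continuous_comp c2 (differentiable_continuous dX).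
have c12 := continuousM c1 c2d.
split; [exact: (continuousD c3 c12)|exact: (continuousB c3 c12)].
Qed.

Lemma shear_continuous b : continuous (to_flat_chart b) /\ continuous (of_flat_chart b).
Proof.
have c1 (v : V3) : {for v, continuous (fst : V3 -> CC R)} by exact: cvg_fst.
have c21 (v : V3) : {for v, continuous (fun w : V3 => w.2.1)}.
  exact/differentiable_continuous/dif21.
have c22 (v : V3) : {for v, continuous (fun w : V3 => w.2.2)}.
  exact/differentiable_continuous/dif22.
have ca (v : V3) : {for v, continuous (fun w : V3 => csq w.1)}.
  by apply: (continuous_comp (c1 v)); exact: csq_continuous.
have cb (v : V3) : {for v, continuous (fun w : V3 => csq (- w.1))}.
  by apply: (continuous_comp (continuousN (c1 v))); exact: csq_continuous.
split=> v; case: b.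
- change {for v, continuous (fun w : V3 => (w.1, (w.2.1, w.2.2 - csq w.1 * w.2.1 ^+ d)))}.
  have [_ h] := cont_shear (ca v) (c21 v) (c22 v).
  exact: (cont_pair (c1 v) (cont_pair (c21 v) h)).
- change {for v, continuous (fun w : V3 => (w.1, (w.2.1 - csq (- w.1) * w.2.2 ^+ d, w.2.2)))}.
  have [_ h] := cont_shear (cb v) (c22 v) (c21 v).
  exact: (cont_pair (c1 v) (cont_pair h (c22 v))).
- change {for v, continuous (fun w : V3 => (w.1, (w.2.1, w.2.2 + csq w.1 * w.2.1 ^+ d)))}.
  have [h _] := cont_shear (ca v) (c21 v) (c22 v).
  exact: (cont_pair (c1 v) (cont_pair (c21 v) h)).
- change {for v, continuous (fun w : V3 => (w.1, (w.2.1 + csq (- w.1) * w.2.2 ^+ d, w.2.2)))}.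
  have [h _] := cont_shear (cb v) (c22 v) (c21 v).
  exact: (cont_pair (c1 v) (cont_pair h (c22 v))).
Qed.

Lemma open_re_gt (c : R) : open [set z : CC R | c < re z].
Proof.
rewrite openE => z /= hz; apply/nbhsCP; exists (re z - c); first by rewrite subr_gt0.
by move=> w hw; have := re_le (w - z); rewrite reB ler_norml => /andP[h1 h2] /=; lra.
Qed.
Lemma open_re_lt (c : R) : open [set z : CC R | re z < c].
Proof.
rewrite openE => z /= hz; apply/nbhsCP; exists (c - re z); first by rewrite subr_gt0.
by move=> w hw; have := re_le (w - z); rewrite reB ler_norml => /andP[h1 h2] /=; lra.
Qed.

Lemma half_base_open b : open (half_base b).
Proof. by case: b; apply: openI => //; [exact: open_re_gt|exact: open_re_lt]. Qed.

Lemma dif_shearV (g1 g2 g3 : V3 -> CC R) (v : V3) :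
  differentiable g1 v -> differentiable g2 v -> differentiable g3 v ->
  differentiable (fun w => g3 w + g1 w * g2 w ^+ d) v.
Proof.
move=> d1 d2 d3.
exact: (differentiableD d3 (differentiableM d1 (dif_X d d2))).
Qed.

(** If the charts differ, the base point is in the strip |Re| < 1/4, where both
    square roots are differentiable. *)
Lemma transition_diff a b (v : V3) : half_base a v.1 -> half_base b v.1 ->
  differentiable (fun w : V3 => shear a w.1 (unshear b w.1 w.2)) v.
Proof.
have [-> _ _|ab] := eqVneq a b.
  under eq_fun do rewrite unshearK; exact: dif_snd.
move=> Ua Ub.
have [ra rb] : -1 / 4 < re v.1 /\ re v.1 < 1 / 4.
  by case: a b ab Ua Ub => -[] // _ [_ h1] [_ h2].
have d1 := dif_fst v; have d21 := dif21 v; have d22 := dif22 v.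
have da : differentiable (fun w : V3 => csq w.1) v.
  by apply: (differentiable_comp d1); exact: csq_diff.
have db : differentiable (fun w : V3 => csq (- w.1)) v.
  have n1 : differentiable (fun w : V3 => - w.1) v by exact: differentiableN.
  have h : differentiable (@csq R) (- v.1) by apply: csq_diff; rewrite reN; lra.
  exact: (@differentiable_comp _ _ _ _ (fun w : V3 => - w.1) (@csq R)).
case: a ab {Ua}; case: b {Ub} => ab.
- by case/negP: ab; exact: isT.
- change (differentiable (fun w : V3 => (w.2.1 + csq (- w.1) * w.2.2 ^+ d,
    w.2.2 - csq w.1 * (w.2.1 + csq (- w.1) * w.2.2 ^+ d) ^+ d)) v).
  have s1 := dif_shearV db d22 d21.
  exact: (differentiable_pair s1 (dif_shear d da s1 d22)).
- change (differentiable (fun w : V3 => (w.2.1 - csq (- w.1) *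
    (w.2.2 + csq w.1 * w.2.1 ^+ d) ^+ d, w.2.2 + csq w.1 * w.2.1 ^+ d)) v).
  have s1 := dif_shearV da d21 d22.
  exact: (differentiable_pair (dif_shear d db s1 d21) s1).
- by case/negP: ab; exact: isT.
Qed.

End bundle_data.

(** * The bundle *)

Section polynomial_maps.
Variable R : realType.
Local Notation F2 := (CC R * CC R)%type.

(** Closure properties are easier to state for one component at a time. *)
Definition is_pol (f : F2 -> CC R) :=
  exists P : {poly {poly CC R}}, forall z, f z = P.[z.1, z.2].

Lemma pol_fst : is_pol fst.
Proof. by exists 'X => z; rewrite hornerX hornerC. Qed.
Lemma pol_snd : is_pol snd.
Proof. by exists 'X%:P => z; rewrite hornerC hornerX. Qed.
Lemma pol_cst c : is_pol (fun=> c).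
Proof. by exists c%:P%:P => z; rewrite !hornerC. Qed.
Lemma pol_add f g : is_pol f -> is_pol g -> is_pol (fun z => f z + g z).
Proof. by move=> [P HP] [Q HQ]; exists (P + Q) => z; rewrite HP HQ !hornerD. Qed.
Lemma pol_mul f g : is_pol f -> is_pol g -> is_pol (fun z => f z * g z).
Proof. by move=> [P HP] [Q HQ]; exists (P * Q) => z; rewrite HP HQ !hornerM. Qed.
Lemma pol_exp f n : is_pol f -> is_pol (fun z => f z ^+ n).
Proof.
by move=> [P HP]; exists (P ^+ n) => z; rewrite HP !horner_exp.
Qed.
Lemma pol_shear c f g n : is_pol f -> is_pol g ->
  is_pol (fun z => f z + c * g z ^+ n) /\ is_pol (fun z => f z - c * g z ^+ n).
Proof.
move=> pf pg; split; first by apply: pol_add => //; apply: pol_mul; [exact: pol_cst|exact: pol_exp].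
have E : (fun z => f z - c * g z ^+ n) = (fun z => f z + (- c) * g z ^+ n).
  by apply/funext => z; rewrite mulNr.
by rewrite E; apply: pol_add => //; apply: pol_mul; [exact: pol_cst|exact: pol_exp].
Qed.

Lemma transition_polynomial d a b (z : CC R) :
  polynomial_map (fun w : F2 => shear d a z (unshear d b z w)).
Proof.
suff [p1 p2] : is_pol (fun w => (shear d a z (unshear d b z w)).1) /\
    is_pol (fun w => (shear d a z (unshear d b z w)).2).
  case: p1 p2 => P HP [Q HQ]; exists P, Q => w.
  by rewrite -HP -HQ -surjective_pairing.
have pf := pol_fst; have ps := pol_snd.
have [q1 _] := pol_shear (csq z) d ps pf.
have [q2 _] := pol_shear (csq (- z)) d pf ps.
case: a; case: b => /=.
- by split; [|exact: (pol_shear (csq z) d q1 pf).2].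
- by split; [|exact: (pol_shear (csq z) d ps q2).2].
- by split; [exact: (pol_shear (csq (- z)) d pf q1).2|].
- by split; [exact: (pol_shear (csq (- z)) d q2 ps).2|].
Qed.

Lemma transition_automorphism d a b (z : CC R) :
  polynomial_automorphism (fun w : F2 => shear d a z (unshear d b z w)).
Proof.
split; first exact: transition_polynomial.
exists (fun w => shear d b z (unshear d a z w)); split; first exact: transition_polynomial.
  by move=> w; rewrite shearK unshearK.
by move=> w; rewrite shearK unshearK.
Qed.

End polynomial_maps.

Section bundle.
Variables (R : realType) (B : set (CC R)) (d : nat).
Hypotheses (Bo : open B) (B1 : forall z : CC R, nc z < 1 -> B z).
Local Notation V3 := (CC R * (CC R * CC R))%type.
Local Notation F2 := (CC R * CC R)%type.
Local Notation T := (total_pts B).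
Local Notation to_total := (to_total B1).

Lemma to_total_continuous (v : V3) : B v.1 -> {for v, continuous to_total}.
Proof.
move=> Bv A /nbhs_total_ptsP[r r0 HA].
have nB : nbhs v [set w : V3 | B w.1].
  have c1 : {for v, continuous (fst : V3 -> CC R)} by exact: cvg_fst.
  by apply: c1; exact: open_nbhs_nbhs.
have nr : nbhs v [set w : V3 | [/\ nc (w.1 - v.1) < r, nc (w.2.1 - v.2.1) < r &
    nc (w.2.2 - v.2.2) < r]].
  by apply/nbhsV3P; exists r.
apply: filterS2 nB nr => w /= Bw [h1 h2 h3].
by apply: HA; rewrite !to_totalK.
Qed.

Definition chart_map b (e : T) : V3 := to_flat_chart d b (val e).
Definition chart_inv b (v : V3) : T := to_total (of_flat_chart d b v).

Lemma of_flat_chartK b (v : V3) : to_flat_chart d b (of_flat_chart d b v) = v.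
Proof. by case: v => z w; rewrite /to_flat_chart /of_flat_chart /= unshearK. Qed.
Lemma to_flat_chartK b (v : V3) : of_flat_chart d b (to_flat_chart d b v) = v.
Proof. by case: v => z w; rewrite /to_flat_chart /of_flat_chart /= shearK. Qed.

Lemma chart_inv_val b v : B v.1 -> val (chart_inv b v) = of_flat_chart d b v.
Proof. by move=> Bv; rewrite /chart_inv to_totalK. Qed.

Definition chart_dom b : set T := [set e | half_base B b (val e).1].
Definition chart_img b : set V3 := [set v | half_base B b v.1].

Lemma cont_val1 : continuous (fun e : T => (val e).1).
Proof.
move=> e; have c1 : {for (val e : V3), continuous (fst : V3 -> CC R)} by exact: cvg_fst.
exact: (continuous_comp (@val_continuous _ B e) c1).
Qed.

Lemma chart_dom_open b : open (chart_dom b).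
Proof. by apply: open_comp; [move=> e _; exact: cont_val1|exact: half_base_open]. Qed.
Lemma chart_img_open b : open (chart_img b).
Proof. by apply: open_comp; [move=> v _; exact: cvg_fst|exact: half_base_open]. Qed.

Lemma dom_img b e : chart_dom b e -> chart_img b (chart_map b e).
Proof. by []. Qed.
Lemma img_dom b v : chart_img b v -> chart_dom b (chart_inv b v).
Proof. by move=> h; rewrite /chart_dom /= chart_inv_val //; case: h. Qed.
Lemma chart_mapK b e : chart_dom b e -> chart_inv b (chart_map b e) = e.
Proof. by move=> _; rewrite /chart_inv /chart_map to_flat_chartK to_total_val. Qed.
Lemma chart_invK b v : chart_img b v -> chart_map b (chart_inv b v) = v.
Proof. by move=> [Bv _]; rewrite /chart_map chart_inv_val // of_flat_chartK. Qed.

Lemma chart_inv_continuous b (v : V3) : B v.1 -> {for v, continuous (chart_inv b)}.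
Proof.
move=> Bv; have [_ c] := @shear_continuous R d b.
by apply: (continuous_comp (c v)); exact: to_total_continuous.
Qed.

Lemma chart_map_continuous b : continuous (chart_map b).
Proof.
by move=> e; have [c _] := @shear_continuous R d b; apply: (continuous_comp (@val_continuous _ B e)); exact: c.
Qed.

Definition shear_chart b : @chart R T V3 :=
  Chart (@chart_dom_open b) (@chart_img_open b) (@dom_img b) (@img_dom b) (@chart_mapK b) (@chart_invK b)
    (continuous_subspaceT (@chart_map_continuous b))
    (continuous_in_subspaceT (fun v h => chart_inv_continuous (proj1 (set_mem h)))).

Lemma near_base b (v : V3) : half_base B b v.1 -> \forall w \near v, half_base B b w.1.
Proof. by move=> h; apply: open_nbhs_nbhs; split => //; exact: chart_img_open. Qed.

Lemma fiber_transition_diff a b (v : V3) : half_base B a v.1 -> half_base B b v.1 ->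
  differentiable (fun w : V3 => (chart_map a (chart_inv b w)).2) v.
Proof.
move=> Ua Ub; apply: differentiable_near (transition_diff d Ua Ub).
apply: filterS (near_base Ub) => w [Bw _].
by rewrite /chart_map chart_inv_val.
Qed.

Lemma base_diff b (v : V3) : B v.1 -> half_base B b v.1 ->
  differentiable (fun w : V3 => (val (chart_inv b w)).1) v.
Proof.
move=> Bv Ub; apply: differentiable_near (dif_fst v).
by apply: filterS (near_base Ub) => w [Bw _]; rewrite chart_inv_val.
Qed.

Lemma chart_transition_diff a b (v : V3) : half_base B a v.1 -> half_base B b v.1 ->
  differentiable (chart_map a \o chart_inv b) v.
Proof.
move=> Ua Ub.
have dp := differentiable_pair (base_diff (proj1 Ub) Ub) (fiber_transition_diff Ua Ub).
by apply: differentiable_near dp; apply: filterS (near_base Ub) => w _.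
Qed.

Definition shear_atlas : set (@chart R T V3) := range shear_chart.

Lemma half_base_cover z : B z -> half_base B true z \/ half_base B false z.
Proof.
move=> Bz; have [h|h] := ltP (re z) (1 / 4); first by right.
by left; split => //; lra.
Qed.

Lemma shear_atlas_cover (e : T) : exists2 c, shear_atlas c & cdom c e.
Proof.
by have [h|h] := half_base_cover (total_pts_base e); [exists (shear_chart true)|exists (shear_chart false)] => //; eexists.
Qed.

Lemma shear_atlas_compatible c c' : shear_atlas c -> shear_atlas c' ->
  holomorphic_on (cimg c `&` cinv c @^-1` cdom c') (cmap c' \o cinv c).
Proof.
move=> [b _ <-] [a _ <-] v [/= Ub Ua].
rewrite /chart_dom /= chart_inv_val in Ua; last by case: Ub.
exact: chart_transition_diff.
Qed.

Definition total_manifold : complex_manifold V3 :=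
  ComplexManifold (@total_pts_hausdorff R B) (@total_pts_second_countable R B) shear_atlas_cover shear_atlas_compatible.

Definition total_proj (e : total_manifold) : CC R := (val (e : T)).1.

Lemma total_proj_holomorphic : holomorphic_function total_proj.
Proof.
move=> c [b _ <-] v [/= Ub _].
exact: base_diff (proj1 Ub) Ub.
Qed.

Definition fiber_coord b (e : total_manifold) : F2 := (chart_map b e).2.

Lemma fiber_coordK b (e : total_manifold) : half_base B b (total_proj e) -> chart_inv b (total_proj e, fiber_coord b e) = e.
Proof. by move=> h; rewrite -[RHS](chart_mapK (b := b)). Qed.

Lemma chart_inv_proj b zeta z : half_base B b zeta -> total_proj (chart_inv b (zeta, z)) = zeta.
Proof. by case=> h _; rewrite /total_proj chart_inv_val. Qed.

Lemma fiber_coord_inv b zeta z : half_base B b zeta -> fiber_coord b (chart_inv b (zeta, z)) = z.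
Proof. by move=> h; rewrite /fiber_coord chart_invK. Qed.

Lemma fiber_coord_holomorphic b : holomorphic_from (total_proj @^-1` half_base B b) (fiber_coord b).
Proof.
move=> c [a _ <-] v [/= Ua]; rewrite /total_proj /= chart_inv_val; last by case: Ua.
move=> Ub; exact: fiber_transition_diff.
Qed.

Lemma chart_inv_holomorphic b : holomorphic_into (half_base B b `*` setT) (chart_inv b : V3 -> total_manifold).
Proof.
split.
  apply: continuous_in_subspaceT => v; rewrite inE => -[[Bv _] _].
  exact: chart_inv_continuous.
move=> c [a _ <-] v [[/= Ub _]]; rewrite /chart_dom /= chart_inv_val; last by case: Ub.
move=> Ua; exact: chart_transition_diff.
Qed.

Definition half_trivialization b : trivialization total_proj (half_base B b) :=
  Trivialization (@fiber_coordK b) (@chart_inv_proj b) (@fiber_coord_inv b) (@fiber_coord_holomorphic b) (@chart_inv_holomorphic b).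

Lemma total_locally_trivial zeta : B zeta -> exists V : set (CC R),
  [/\ open V, V `<=` B, V zeta & inhabited (trivialization total_proj V)].
Proof.
move=> Bz; have [b Ub] : exists b, half_base B b zeta.
  by have [h|h] := half_base_cover Bz; [exists true|exists false].
exists (half_base B b); split => //; [exact: half_base_open|by move=> z []|exact: (inhabits (half_trivialization b))].
Qed.

Definition shear_bundle : holomorphic_bundle B F2 :=
  @HolomorphicBundle R B F2 total_manifold total_proj (fun e => total_pts_base e) total_proj_holomorphic total_locally_trivial.

Lemma cover_eq : \bigcup_b half_base B b = B.
Proof.
apply/seteqP; split => z; first by case=> b _ [].
by move=> /half_base_cover[h|h]; [exists true|exists false].
Qed.

Definition shear_cover : trivializing_cover shear_bundle :=
  @TrivializingCover R B F2 shear_bundle bool (half_base B) half_trivialization (half_base_open Bo) cover_eq.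

Lemma shear_gluing_polynomial : polynomial_gluing shear_cover.
Proof.
move=> a b; split.
  by move=> v [[/= Ua Ub] _]; exact: fiber_transition_diff.
move=> zeta Ua Ub.
have -> : gluing (C := shear_cover) a b zeta = fun w => shear d a zeta (unshear d b zeta w).
  apply/funext => w; rewrite /gluing /= /fiber_coord /chart_map chart_inv_val //; by case: Ub.
exact: transition_automorphism.
Qed.

End bundle.

(** * Two points that no holomorphic function separates *)

Section conclusion.
Variables (R : realType) (B : set (CC R)) (d : nat).
Hypotheses (Bo : open B) (B1 : forall z : CC R, nc z < 1 -> B z).
Hypotheses (d0 : (0 < d)%N) (dlarge : 6 * 100 ^+ 8 <= (50 / 49 : R) ^+ d).
Local Notation M := (total_manifold d Bo B1).
Local Notation E := (shear_bundle d Bo B1).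

Definition point (x : CC R) : M := to_total B1 (0, (x, 0)).

Lemma point_neq : point 1 <> point 0.
Proof.
have B0 : B 0 by apply: B1; rewrite nc0.
move=> /(congr1 (fun e : total_pts B => (val e).2.1)); rewrite !to_totalK //= => /eqP.
by rewrite oner_eq0.
Qed.

(** In the two charts, f is a pair of functions to which
    [fiber_points_not_separated] applies. *)
Lemma not_separated (f : M -> CC R) : holomorphic_function f -> f (point 1) = f (point 0).
Proof.
move=> hf.
have fdiff b v : half_base B b v.1 -> differentiable (f \o chart_inv d B1 b) v.
  by move=> Ub; apply: (hf (shear_chart d Bo B1 b)); [exists b|split].
have hP z x y : nc z < 1 -> -1 / 4 < re z -> differentiable (f \o chart_inv d B1 true) (z, (x, y)).
  by move=> /B1 Bz rz; apply: fdiff; split.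
have hQ z x y : nc z < 1 -> re z < 1 / 4 -> differentiable (f \o chart_inv d B1 false) (z, (x, y)).
  by move=> /B1 Bz rz; apply: fdiff; split.
have := fiber_points_not_separated d0 dlarge hP hQ.
rewrite /= /chart_inv /of_flat_chart /unshear /= expr1n mulr1 addNr expr0n gtn_eqF // mulr0 addr0.
by apply=> z x y _ _ _; rewrite !subrK.
Qed.

Lemma shear_bundle_not_stein : ~ stein (total_space E).
Proof.
case=> _ sep _; have [f hf] := sep _ _ point_neq.
by apply; exact: not_separated.
Qed.

(** Each component of a global trivialization is a holomorphic function, and so
    takes equal values at the two points of [point_neq]. *)
Lemma shear_bundle_not_trivial : ~ trivial_bundle E.
Proof.
case=> tr; have p x : bundle_proj (h := E) (point x) = 0.
  by rewrite /= /total_proj to_totalK //=; apply: B1; rewrite nc0.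
have B0 : B 0 by apply: B1; rewrite nc0.
have comp (g : CC R * CC R -> CC R) : (forall w, differentiable g w) ->
    g (tmap tr (point 1)) = g (tmap tr (point 0)).
  move=> dg; apply: (@not_separated (g \o tmap tr)) => c ac v [cv _].
  apply: (@differentiable_comp _ _ _ _ (tmap tr \o cinv c) g); last exact: dg.
  by apply: (tmap_holomorphic tr ac); split => //; exact: bundle_proj_base.
have e1 := comp fst (@dif_fst _ _ _); have e2 := comp snd (@dif_snd _ _ _).
apply: point_neq.
have k1 := @tmapK _ _ _ _ _ tr (point 1); have k0 := @tmapK _ _ _ _ _ tr (point 0).
rewrite (p 1) in k1; rewrite (p 0) in k0.
rewrite -[LHS](k1 B0) -[RHS](k0 B0).
by rewrite (surjective_pairing (tmap tr (point 1))) e1 e2 -surjective_pairing.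
Qed.

End conclusion.

Unset Implicit Arguments.

Theorem mainTheorem3 (R : realType) (B : set (CC R))
    (hB : B = @unit_disc R \/ B = [set: CC R]) :
  exists E : holomorphic_bundle B (CC R * CC R)%type,
    [/\ (exists C : trivializing_cover E, polynomial_gluing C),
        ~ trivial_bundle E
      & ~ stein (total_space E)].
Proof.
have Bo : open B.
  case: hB => ->; last exact: openT.
  rewrite openE => z zd; apply/nbhsCP.
  have {zd}z1 : nc z < 1 by move: zd; rewrite /unit_disc /= normE -[1]/(rc 1) /rc ltcR.
  exists (1 - nc z); first by rewrite subr_gt0.
  move=> w hw; rewrite /unit_disc /= normE -[1]/(rc 1) /rc ltcR.
  by have := ncBD w z; lra.
have B1 z : nc z < 1 -> B z.
  by case: hB => -> // z1; rewrite /unit_disc /= normE -[1]/(rc 1) /rc ltcR.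
have [d dlarge] : exists d, 6 * 100 ^+ 8 < (50 / 49 : R) ^+ d.
  by apply: expr_unbounded; rewrite ltr_pdivlMr // mul1r ltr_nat.
have d0 : (0 < d)%N.
  case: d dlarge => // h; move: h; rewrite expr0 ltNge => /negP; case.
  by rewrite mulr_ege1 ?exprn_ege1 // ler1n.
exists (shear_bundle d Bo B1); split.
- by exists (shear_cover d Bo B1); exact: shear_gluing_polynomial.
- exact: (shear_bundle_not_trivial d0 (ltW dlarge)).
- exact: (shear_bundle_not_stein d0 (ltW dlarge)).
Qed.
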